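(* The complex cubic fields whose shape lies on the boundary of the Gauss fundamental domain $\mathcal{G}=\{x+iy:0\le x\le\frac12,\ x^2+y^2\ge1\}$ are exactly the wild pure cubic fields.
   Context: A complex cubic field $K$ has one real and two complex embeddings $\sigma_1,\sigma_2,\sigma_3$. With $\alpha^\perp:=3\alpha-\mathrm{Tr}_{K/\mathbf{Q}}(\alpha)$ and $1,\alpha_1,\alpha_2$ a $\mathbf{Z}$-basis of $\mathcal{O}_K$, let $M(x,y)=\sum_i|\sigma_i(x\alpha_1^\perp+y\alpha_2^\perp)|^2=rx^2+sxy+ty^2$ and $z(M)=\frac{s}{2r}+i\frac{\sqrt{4rt-s^2}}{2r}$. The shape $\mathrm{sh}(K)$ is the unique point of $\mathcal{G}$ in the $\mathrm{GL}_2(\mathbf{Z})$-orbit of $z(M)$ (with $g$ acting by $z\mapsto\frac{az+b}{cz+d}$ if $\det g=1$, $z\mapsto\frac{a\bar z+b}{c\bar z+d}$ if $\det g=-1$). A pure cubic field is one isomorphic to $\mathbf{Q}(\sqrt[3]{m})$, $m\in\mathbf{Q}$ a non-cube; it is wild if $3$ is wildly (i.e. totally, $3\mathcal{O}_K=\mathfrak{p}^3$) ramified in it. *)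

(* Defs.v *)
From HB Require Import structures.
From mathcomp Require Import all_boot all_order all_algebra all_field.
From mathcomp Require Import complex.
From mathcomp Require Import all_classical all_reals all_analysis.

Set Implicit Arguments.
Unset Strict Implicit.
Unset Printing Implicit Defensive.

Import Order.TTheory GRing.Theory Num.Theory.
Import numFieldNormedType.Exports.

Local Open Scope classical_set_scope.
Local Open Scope card_scope.
Local Open Scope ring_scope.

Definition boundary (T : topologicalType) (A : set T) : set T :=
  closure A `\` interior A.

Section NumberField.
Variable K : fieldExtType rat.

Definition ring_of_integers : set K :=
  [set x | integralOver (intr : int -> K) x].

Definition is_integral_basis (a1 a2 : K) : Prop :=
  (forall x : K, ring_of_integers x <->
     exists c0 c1 c2 : int, x = c0%:~R + a1 *~ c1 + a2 *~ c2) /\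
  (forall c0 c1 c2 : int, c0%:~R + a1 *~ c1 + a2 *~ c2 = 0 ->
     [/\ c0 = 0, c1 = 0 & c2 = 0]).

(* The trace of multiplication by a on the rat-vector space K; galTrace is    *)
(* not usable here, as it sums over automorphisms and a complex cubic field   *)
(* is not normal.                                                             *)
Definition field_trace (a : K) : rat :=
  \tr (passmx.mxof (vbasis {:K}) (vbasis {:K}) (amull a)).

Definition perp (a : K) : K := 3%:R * a - (field_trace a)%:A.

Definition is_ideal (I : set K) : Prop :=
  [/\ I `<=` ring_of_integers, I 0,
      forall x y, I x -> I y -> I (x + y) &
      forall a x, ring_of_integers a -> I x -> I (a * x)].

Definition is_prime_ideal (P : set K) : Prop :=
  [/\ is_ideal P, ~ P 1 &
      forall x y, ring_of_integers x -> ring_of_integers y ->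
        P (x * y) -> P x \/ P y].

Definition ideal_mul (I J : set K) : set K :=
  [set x | exists n (u v : 'I_n -> K),
     (forall i, I (u i) /\ J (v i)) /\ x = \sum_(i < n) u i * v i].

Definition wildly_ramified_at_3 : Prop :=
  exists P : set K, is_prime_ideal P /\
    [set 3%:R * x | x in ring_of_integers] = ideal_mul (ideal_mul P P) P.

(* K is isomorphic to Q(m^(1/3)) iff it is generated over Q by an element     *)
(* whose cube is m (the image of the cube root under the isomorphism).        *)
Definition is_pure_cubic : Prop :=
  exists m : rat, (forall q : rat, q ^+ 3 <> m) /\
    exists a : K, a ^+ 3 = m%:A /\ <<1; a>>%VS = {:K}%VS.

Definition is_wild_pure_cubic : Prop := is_pure_cubic /\ wildly_ramified_at_3.

End NumberField.

Section Shape.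
Variable R : realType.

(* Im z > 0 makes explicit that the domain lies in the upper half-plane.      *)
(* The ascription selects the norm topology of R[i].                          *)
Definition gauss_domain : set (R[i] : numFieldType) :=
  [set z | [/\ 0 < complex.Im z, 0 <= complex.Re z <= 2^-1 &
               1 <= complex.Re z ^+ 2 + complex.Im z ^+ 2]].

Definition GL2Z_act (g : 'M[int]_2) (z : R[i]) : R[i] :=
  let w := if \det g == 1 then z else conjc z in
  ((g 0 0)%:~R * w + (g 0 1)%:~R) / ((g 1 0)%:~R * w + (g 1 1)%:~R).

Definition form_root (r s t : R) : R[i] :=
  Complex (s / (2 * r)) (Num.sqrt (4 * r * t - s ^+ 2) / (2 * r)).

Variable K : fieldExtType rat.

Definition embeddings : set (K -> R[i]) :=
  [set f : K -> R[i] |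
     exists phi : {rmorphism K -> R[i]}, f = phi :> (K -> R[i])].

Definition real_valued : set (K -> R[i]) :=
  [set f | forall x, complex.Im (f x) = 0].

Definition is_complex_cubic : Prop :=
  [/\ \dim {:K} = 3%N,
      embeddings `&` real_valued #= `I_1 &
      embeddings `\` real_valued #= `I_2].

Definition minkowski_form (a1 a2 : K) (x y : int) : R :=
  \sum_(f \in embeddings)
    Normc.normc (f (perp a1 *~ x + perp a2 *~ y)) ^+ 2.

Definition shape_points : set R[i] :=
  [set z | gauss_domain z /\
     exists (a1 a2 : K) (r s t : R),
       [/\ is_integral_basis a1 a2,
           forall x y : int, minkowski_form a1 a2 x y =
             r * x%:~R ^+ 2 + s * x%:~R * y%:~R + t * y%:~R ^+ 2 &
           exists2 g : 'M[int]_2,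
             g \in unitmx & z = GL2Z_act g (form_root r s t)]].

(* shape_points is a singleton for a complex cubic field; the value 0         *)
(* returned on an empty set is outside gauss_domain and its boundary.         *)
Definition field_shape : R[i] := xget 0 shape_points.

End Shape.

(* Main.v *)
Require Import Defs.
From HB Require Import structures.
From mathcomp Require Import all_boot all_order all_algebra all_field.
From mathcomp Require Import complex.
From mathcomp Require Import all_classical all_reals all_analysis.
From mathcomp Require Import ring lra zify.

(** Let rho be the real embedding of a complex cubic field K.  On elements of trace
    zero the form is M(w) = 3 rho(w)^2 - Tr(w^2), so M(x + y) = M(x - y) holds exactly
    when x y is rational.  A reduced basis whose shape lies on the boundary of the
    Gauss domain yields such x, y spanning a sublattice of index at most 2 of the
    perps of the integers; since Tr x = Tr y = 0 and x y is rational, x^3 is rational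
    and K is pure.

    Let al, be be the cube roots of m = a b^2 and of a^2 b, with a, b squarefree and
    coprime.  A norm computation gives 3 O <= Z[al, be].  If 9 does not divide m^2 - 1,
    then O = Z[al, be] and 3 O = (al - m, 3)^3 (up to exchanging a and b).  Otherwise
    e = (1 + m al + al^2) / 3 is an integer which is a nontrivial idempotent of O / 3 O
    modulo nilpotents, so 3 is not totally ramified, and the perps of the integers
    contain perp e but meet each axis in multiples of 3, which excludes x and y.

    Conversely, when O = Z[al, be], the form is diagonal in al, be, and a diagonal
    form has no reduced basis in the interior of the Gauss domain. *)

Set Implicit Arguments.
Unset Strict Implicit.
Unset Printing Implicit Defensive.
Import Order.TTheory GRing.Theory Num.Theory.
Import numFieldNormedType.Exports.
Local Open Scope classical_set_scope.
Local Open Scope ring_scope.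

(** * Power-free integers and divisibility *)

Definition power_free (k n : nat) : Prop :=
  forall d : nat, (d ^ k %| n)%N -> d = 1%N.

Lemma power_free_gt0 (k n : nat) : power_free k n -> (0 < n)%N.
Proof. by case: n => // /(_ 2%N (dvdn0 _)). Qed.

Lemma power_free_natr_neq0 (F : numDomainType) (k n : nat) :
  power_free k n -> n%:R != 0 :> F.
Proof. by move/power_free_gt0; rewrite pnatr_eq0 lt0n. Qed.

Lemma power_free_part (k n : nat) : (0 < k)%N -> (0 < n)%N ->
  exists c m : nat, [/\ (0 < c)%N, n = (c ^ k * m)%N & power_free k m].
Proof.
move=> k_gt0 n_gt0.
have some_power : exists c, (c ^ k %| n)%N by exists 1%N; rewrite exp1n dvd1n.
have bounded c : (c ^ k %| n)%N -> (c <= n)%N.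
  move=> /(dvdn_leq n_gt0); apply: leq_trans.
  by case: c => // c; rewrite -{1}(expn1 c.+1) leq_pexp2l.
case: (ex_maxnP some_power bounded) => c /dvdnP[m n_eq] c_max.
have /andP[m_gt0 ck_gt0] : (0 < m)%N && (0 < c ^ k)%N by rewrite -muln_gt0 -n_eq.
have c_gt0 : (0 < c)%N by rewrite expn_gt0 eqn0Ngt k_gt0 orbF in ck_gt0.
exists c, m; split=> //; first by rewrite mulnC.
move=> d d_dvd; apply/eqP; rewrite eqn_leq; apply/andP; split.
  by rewrite -(leq_pmul2r c_gt0) mul1n c_max// expnMn n_eq dvdn_mul.
by rewrite lt0n; apply: contraTneq m_gt0 => d0; move: d_dvd;
  rewrite d0 exp0n ?dvd0n -?eqn0Ngt.
Qed.

Lemma cube_free_split (n : nat) : power_free 3 n ->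
  exists a b : nat,
    [/\ n = (a * b ^ 2)%N, power_free 2 a, power_free 2 b & coprime a b].
Proof.
move=> n_free.
have [b [a [_ n_eq a_free]]] := power_free_part (isT : 0 < 2)%N (power_free_gt0 n_free).
exists a, b; split=> //; first by rewrite mulnC.
- move=> d /dvdnP[k b_eq]; apply: n_free.
  by rewrite n_eq b_eq expnMn -expnM -mulnA mulnCA dvdn_mulr// dvdn_exp2l.
- apply/eqP/n_free; rewrite n_eq (expnSr _ 2).
  by apply: dvdn_mul; rewrite ?dvdn_gcdl// dvdn_exp2r// dvdn_gcdr.
Qed.

Lemma squarefree_dvdnX (a c n : nat) :
  power_free 2 a -> (a %| c ^ n)%N -> (a %| c)%N.
Proof.
move=> a_free a_dvd.
have g_gt0 : (0 < gcdn a c)%N by rewrite gcdn_gt0 (power_free_gt0 a_free).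
have [a' a_eq] := dvdnP (dvdn_gcdl a c).
have [c' c_eq] := dvdnP (dvdn_gcdr a c).
have cop_c' : coprime a' c'.
  by rewrite /coprime -(eqn_pmul2r g_gt0) mul1n muln_gcdl -a_eq -c_eq.
have cop_g : coprime a' (gcdn a c).
  rewrite /coprime; apply/eqP/a_free; rewrite [X in (_ %| X)%N]a_eq.
  by apply: dvdn_mul; [apply: dvdn_gcdl | apply: dvdn_gcdr].
have : (a' %| c' ^ n * gcdn a c ^ n)%N.
  rewrite -expnMn -c_eq; apply: dvdn_trans a_dvd.
  by rewrite [X in (_ %| X)%N]a_eq dvdn_mulr.
rewrite Gauss_dvdr ?coprimeXr// -(muln1 (_ ^ n)%N) Gauss_dvdr ?coprimeXr// dvdn1.
by move=> /eqP a'1; rewrite a_eq a'1 mul1n dvdn_gcdr.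
Qed.

Lemma squarefree_dvdzX (a : nat) (c : int) (n : nat) :
  power_free 2 a -> (a %| c ^+ n)%Z -> (a %| c)%Z.
Proof. by move=> a_free; rewrite !dvdzE abszX; apply: squarefree_dvdnX. Qed.

Lemma squarefree_dvdz_cube_sum (a b : nat) (c d : int) :
  power_free 2 a -> power_free 2 b -> coprime a b ->
  ((a%:Z * b%:Z) ^+ 2 %| b%:Z * c ^+ 3 + a%:Z * d ^+ 3)%Z -> (a%:Z * b%:Z %| c)%Z.
Proof.
move=> a_free b_free cop_ab /dvdzP[k sum_eq].
have cop_ba : coprime b a by rewrite coprime_sym.
have /dvdzP[c' c_eq] : (a %| c)%Z.
  apply: (squarefree_dvdzX (n := 3) a_free).
  rewrite -(@Gauss_dvdzr _ b)//; apply/dvdzP.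
  by exists (k * a%:Z * b%:Z ^+ 2 - d ^+ 3); lra.
have /dvdzP[d' d_eq] : (b %| d)%Z.
  apply: (squarefree_dvdzX (n := 3) b_free).
  rewrite -(@Gauss_dvdzr _ a)//; apply/dvdzP.
  by exists (k * a%:Z ^+ 2 * b%:Z - c ^+ 3); lra.
have ab_neq0 : a%:Z * b%:Z != 0.
  by rewrite mulf_neq0// -lt0n (power_free_gt0 a_free, power_free_gt0 b_free).
have sum_eq' : a%:Z ^+ 2 * c' ^+ 3 + b%:Z ^+ 2 * d' ^+ 3 = k * a%:Z * b%:Z.
  by apply: (mulfI ab_neq0); rewrite c_eq d_eq in sum_eq; lra.
have /dvdzP[c'' c'_eq] : (b %| c')%Z.
  apply: (squarefree_dvdzX (n := 3) b_free).
  rewrite -(@Gauss_dvdzr _ (a%:Z ^+ 2)) ?coprimezXr//; apply/dvdzP.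
  by exists (k * a%:Z - b%:Z * d' ^+ 3); lra.
by rewrite c_eq c'_eq; apply/dvdzP; exists c''; ring.
Qed.

Lemma Euclid_dvdzM (p : nat) (x y : int) : prime p ->
  (p %| x * y)%Z = (p %| x)%Z || (p %| y)%Z.
Proof. by move=> p_prime; rewrite !dvdzE abszM Euclid_dvdM. Qed.

Lemma Euclid_dvdzX (p : nat) (x : int) (n : nat) : prime p ->
  (p %| x ^+ n)%Z = (p %| x)%Z && (0 < n)%N.
Proof. by move=> p_prime; rewrite !dvdzE abszX Euclid_dvdX. Qed.

Lemma Fermat_Fp (p : nat) (x : 'F_p) : prime p -> x != 0 -> x ^+ p.-1 = 1.
Proof.
move=> p_prime x_neq0; apply: (mulfI x_neq0).
by rewrite -exprS prednK ?prime_gt0// mulr1 -[RHS]expf_card card_Fp.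
Qed.

Lemma Fermat_dvdz (p : nat) (x : int) : prime p ->
  ~~ (p %| x)%Z -> (p %| x ^+ p.-1 - 1)%Z.
Proof.
move=> p_prime; rewrite !(dvdz_pcharf (pchar_Fp p_prime)) rmorphB rmorphXn /=.
by move=> /(Fermat_Fp p_prime)->; rewrite subrr.
Qed.

Lemma Euclid_dvdz_cube_sqr (p : nat) (x : int) : prime p ->
  (p%:Z ^+ 3 %| x ^+ 2)%Z -> (p%:Z ^+ 2 %| x)%Z.
Proof.
move=> p_prime p3_dvd; have p_neq0 : p%:Z != 0 by rewrite -lt0n prime_gt0.
have : (p %| x ^+ 2)%Z by apply: dvdz_trans p3_dvd; rewrite exprS dvdz_mulr.
rewrite Euclid_dvdzX// andbT => /dvdzP[y x_eq].
have : (p %| y ^+ 2)%Z.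
  by rewrite -(@dvdz_mul2r (p%:Z ^+ 2)) ?expf_neq0// -exprS -exprMn -x_eq.
rewrite Euclid_dvdzX// andbT => /dvdzP[z y_eq].
by apply/dvdzP; exists z; rewrite x_eq y_eq; ring.
Qed.

(** * The norm form of a pure cubic field *)

(* The norm of [x0 + x1 (a b^2)^(1/3) + x2 (a^2 b)^(1/3)]. *)
Definition pure_norm (A : comPzRingType) (a b x0 x1 x2 : A) : A :=
  x0 ^+ 3 + a * b ^+ 2 * x1 ^+ 3 + a ^+ 2 * b * x2 ^+ 3 - 3 * a * b * x0 * x1 * x2.

(* A third of the second elementary symmetric function of the conjugates. *)
Definition pure_minor (A : comPzRingType) (a b x0 x1 x2 : A) : A :=
  x0 ^+ 2 - a * b * x1 * x2.

Lemma rmorph_pure_norm (A B : comPzRingType) (f : {rmorphism A -> B}) (a b x0 x1 x2 : A) :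
  f (pure_norm a b x0 x1 x2) = pure_norm (f a) (f b) (f x0) (f x1) (f x2).
Proof. by rewrite /pure_norm; ring. Qed.

Lemma rmorph_pure_minor (A B : comPzRingType) (f : {rmorphism A -> B})
    (a b x0 x1 x2 : A) :
  f (pure_minor a b x0 x1 x2) = pure_minor (f a) (f b) (f x0) (f x1) (f x2).
Proof. by rewrite /pure_minor; ring. Qed.

(* Cubing is the identity of ['F_3], so the norm equation becomes linear. *)
Lemma pure_norm_F3 (a b x0 x1 x2 : 'F_3) : a != 0 -> b != 0 ->
  pure_minor a b x0 x1 x2 = 0 -> pure_norm a b x0 x1 x2 = 0 ->
  x1 = a * x0 /\ x2 = b * x0.
Proof.
have three0 : 3 = 0 :> 'F_3 by apply/val_inj.
have cube (x : 'F_3) : x ^+ 3 = x by rewrite -[RHS]expf_card card_Fp.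
move=> /(Fermat_Fp (isT : prime 3)) aa /(Fermat_Fp (isT : prime 3)) bb minor0 norm0.
have lin : x0 + a * x1 + b * x2 = 0.
  rewrite -[RHS]norm0 /pure_norm !cube aa bb three0 !mul0r subr0.
  by rewrite mul1r mulr1.
have ax1_bx2 : a * x1 = b * x2.
  apply/eqP; rewrite -subr_eq0 -sqrf_eq0; apply/eqP.
  transitivity ((x0 + a * x1 + b * x2) * (a * x1 + b * x2 - x0)
      + pure_minor a b x0 x1 x2 - 3 * (a * b * x1 * x2));
        first by rewrite /pure_minor; ring.
  by rewrite lin minor0 three0 !mul0r addr0 subrr.
have ax1 : a * x1 = x0.
  transitivity (3 * (a * x1) - (x0 + a * x1 + b * x2) + x0);
    first by rewrite -ax1_bx2; ring.
  by rewrite lin three0 mul0r subr0 add0r.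
have bx2 : b * x2 = x0 by rewrite -ax1_bx2.
by split; [rewrite -ax1 mulrA -expr2 aa mul1r | rewrite -bx2 mulrA -expr2 bb mul1r].
Qed.

Lemma pure_norm_mod3 (a b x0 x1 x2 : int) :
  ~~ (3 %| a)%Z -> ~~ (3 %| b)%Z ->
  (3 %| pure_minor a b x0 x1 x2)%Z -> (3 %| pure_norm a b x0 x1 x2)%Z ->
  (3 %| x1 - a * x0)%Z /\ (3 %| x2 - b * x0)%Z.
Proof.
rewrite !(dvdz_pcharf (pchar_Fp (isT : prime 3))) rmorph_pure_norm rmorph_pure_minor.
rewrite !(rmorphB, rmorphM) /= => a_neq0 b_neq0 /eqP minor0 /eqP norm0.
by have [-> ->] := pure_norm_F3 a_neq0 b_neq0 minor0 norm0; rewrite !subrr.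
Qed.

Lemma pure_norm_dvd27 (a b x0 x1 x2 : int) :
  (3 %| a)%Z -> ~~ (9 %| a)%Z -> ~~ (3 %| b)%Z ->
  (27 %| pure_norm a b x0 x1 x2)%Z ->
  [/\ (3 %| x0)%Z, (3 %| x1)%Z & (3 %| x2)%Z].
Proof.
move=> /dvdzP[a' ->]; rewrite (@dvdz_mul2r 3 3 a')// => a'_ndvd b_ndvd.
rewrite /pure_norm => /dvdzP[l norm_eq].
have dvd3M := fun x y => @Euclid_dvdzM 3 x y isT.
have dvd3X := fun x n => @Euclid_dvdzX 3 x n isT.
have /dvdzP[z0 x0_eq] : (3 %| x0)%Z.
  rewrite -(andbT (3 %| x0)%Z) -(dvd3X _ 3); apply/dvdzP.
  exists (9 * l - a' * b ^+ 2 * x1 ^+ 3 - 3 * a' ^+ 2 * b * x2 ^+ 3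
    + 3 * a' * b * x0 * x1 * x2); lra.
have /dvdzP[z1 x1_eq] : (3 %| x1)%Z.
  have : (3 %| a' * (b ^+ 2 * x1 ^+ 3))%Z.
    apply/dvdzP; exists (3 * l - 3 * z0 ^+ 3 - a' ^+ 2 * b * x2 ^+ 3
      + 3 * a' * b * z0 * x1 * x2).
    by rewrite x0_eq in norm_eq; lra.
  by rewrite dvd3M dvd3M !dvd3X (negPf a'_ndvd) (negPf b_ndvd) !andbT.
have : (3 %| b * (a' ^+ 2 * x2 ^+ 3))%Z.
  apply/dvdzP; exists (l - z0 ^+ 3 - 3 * a' * b ^+ 2 * z1 ^+ 3
    + 3 * a' * b * z0 * z1 * x2).
  by rewrite x0_eq x1_eq in norm_eq; lra.
rewrite dvd3M dvd3M !dvd3X (negPf a'_ndvd) (negPf b_ndvd) !andbT => x2_dvd.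
by split=> //; apply/dvdzP; [exists z0 | exists z1].
Qed.

(** * Rings of integers *)

Lemma integral_rat_is_int (F : fieldType) (phi : {rmorphism rat -> F}) (q : rat) :
  integralOver (intr : int -> F) (phi q) -> q \is a Num.int.
Proof.
move=> [p p_monic p_root].
have q_root : root (map_poly (intr : int -> rat) p) q.
  rewrite -(fmorph_root phi) -map_poly_comp (eq_map_poly (g := intr : int -> F))//.
  by move=> x /=; rewrite rmorph_int.
suff /intrP[n n_eq] : (ratr q : algC) \is a Num.int.
  have -> : q = n%:~R by apply: (fmorph_inj (@ratr algC)); rewrite /= n_eq rmorph_int.
  exact: intr_int.
apply: Cint_rat_Aint; first exact: Crat_rat.
apply: (@root_monic_Aint (map_poly (intr : int -> algC) p)).
- rewrite (eq_map_poly (g := ratr \o (intr : int -> rat))).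
    by rewrite map_poly_comp fmorph_root.
  by move=> x /=; rewrite rmorph_int.
- by rewrite monic_map.
- by apply/polyOverP => i; rewrite coef_map rpred_int.
Qed.

Lemma intr_div_is_int (m d : int) : d != 0 ->
  (m%:~R / d%:~R \is a @Num.int rat) = (d %| m)%Z.
Proof.
move=> d_neq0; have d_unit : d%:~R != 0 :> rat by rewrite intr_eq0.
apply/intrP/dvdzP => [[q q_eq]|[q ->]]; exists q.
  by apply/eqP; rewrite -(eqr_int rat) rmorphM /= -q_eq divfK.
by rewrite rmorphM /= mulfK.
Qed.

Section RingOfIntegers.
Variable K : fieldExtType rat.
Implicit Types x y : K.

Lemma ring_of_integersD x y :
  ring_of_integers x -> ring_of_integers y -> ring_of_integers (x + y).
Proof. exact: integral_add. Qed.

Lemma ring_of_integersB x y :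
  ring_of_integers x -> ring_of_integers y -> ring_of_integers (x - y).
Proof. exact: integral_sub. Qed.

Lemma ring_of_integersN x : ring_of_integers x -> ring_of_integers (- x).
Proof. exact: integral_opp. Qed.

Lemma ring_of_integersM x y :
  ring_of_integers x -> ring_of_integers y -> ring_of_integers (x * y).
Proof. exact: integral_mul. Qed.

Lemma ring_of_integers_int (n : int) : ring_of_integers (n%:~R : K).
Proof. exact: integral_id. Qed.

Lemma ring_of_integers_nat (n : nat) : ring_of_integers (n%:R : K).
Proof. exact: integral_nat. Qed.

Lemma ring_of_integersX x (n : nat) : ring_of_integers x -> ring_of_integers (x ^+ n).
Proof.
move=> Ox; elim: n => [|n IHn]; first exact: (ring_of_integers_nat 1).
by rewrite exprS; apply: ring_of_integersM.
Qed.

Lemma ring_of_integers_rat (q : rat) : ring_of_integers (in_alg K q) -> q \is a Num.int.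
Proof. exact: integral_rat_is_int. Qed.

Lemma ring_of_integers_cubic x (e1 e2 e3 : int) :
  x ^+ 3 - e1%:~R * x ^+ 2 + e2%:~R * x - e3%:~R = 0 -> ring_of_integers x.
Proof.
move=> x_root; exists (Poly [:: - e3; e2; - e1; 1]).
  by rewrite monicE lead_coefE (@PolyK _ 0).
rewrite map_Poly /root horner_Poly /= rmorph1 !rmorphN /=.
by apply/eqP; rewrite -[RHS]x_root; ring.
Qed.

Lemma ring_of_integers_rmorph (F : fieldType) (phi : {rmorphism K -> F}) x :
  ring_of_integers x -> integralOver (intr : int -> F) (phi x).
Proof.
move=> /(integral_rmorph phi); congr integralOver.
by apply/funext => n /=; rewrite rmorph_int.
Qed.

End RingOfIntegers.

Ltac integral := repeat first
  [ assumption
  | apply: ring_of_integers_nat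
  | apply: ring_of_integers_int
  | apply: ring_of_integersB
  | apply: ring_of_integersD
  | apply: ring_of_integersN
  | apply: ring_of_integersX
  | apply: ring_of_integersM ].

(** * Rational bases of cubic fields *)

Section RationalBasis.
Variable K : fieldExtType rat.
Implicit Types u v : K.

Definition rat_comb u v (x0 x1 x2 : rat) : K :=
  in_alg K x0 + in_alg K x1 * u + in_alg K x2 * v.

Definition is_rational_basis u v : Prop :=
  (forall x, exists x0 x1 x2, x = rat_comb u v x0 x1 x2) /\
  (forall x0 x1 x2, rat_comb u v x0 x1 x2 = 0 -> [/\ x0 = 0, x1 = 0 & x2 = 0]).

Lemma rat_combC u v x0 x1 x2 : rat_comb u v x0 x1 x2 = rat_comb v u x0 x2 x1.
Proof. by rewrite /rat_comb addrAC. Qed.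

Lemma rat_combD u v x0 x1 x2 y0 y1 y2 :
  rat_comb u v x0 x1 x2 + rat_comb u v y0 y1 y2 =
  rat_comb u v (x0 + y0) (x1 + y1) (x2 + y2).
Proof. by rewrite /rat_comb; ring. Qed.

Lemma rat_combB u v x0 x1 x2 y0 y1 y2 :
  rat_comb u v x0 x1 x2 - rat_comb u v y0 y1 y2 =
  rat_comb u v (x0 - y0) (x1 - y1) (x2 - y2).
Proof. by rewrite /rat_comb; ring. Qed.

Lemma rat_combZ u v c x0 x1 x2 :
  in_alg K c * rat_comb u v x0 x1 x2 = rat_comb u v (c * x0) (c * x1) (c * x2).
Proof. by rewrite /rat_comb; ring. Qed.

Lemma rat_comb_mulrz u v x0 x1 x2 (n : int) :
  rat_comb u v x0 x1 x2 *~ n = rat_comb u v (n%:~R * x0) (n%:~R * x1) (n%:~R * x2).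
Proof. by rewrite -scaler_int -mulr_algl -[_%:A]/(in_alg K _) rat_combZ. Qed.

Lemma rat_comb_intr u v (n0 n1 n2 : int) :
  rat_comb u v n0%:~R n1%:~R n2%:~R = n0%:~R + u *~ n1 + v *~ n2.
Proof. by rewrite /rat_comb !rmorph_int !mulrzl. Qed.

Lemma rat_comb_alg u v q : in_alg K q = rat_comb u v q 0 0.
Proof. by rewrite /rat_comb rmorph0; ring. Qed.

Lemma rat_comb_fst u v : u = rat_comb u v 0 1 0.
Proof. by rewrite /rat_comb rmorph0 rmorph1; ring. Qed.

Lemma rat_comb_snd u v : v = rat_comb u v 0 0 1.
Proof. by rewrite rat_combC -rat_comb_fst. Qed.

Lemma rat_comb_inj u v x0 x1 x2 y0 y1 y2 : is_rational_basis u v ->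
  rat_comb u v x0 x1 x2 = rat_comb u v y0 y1 y2 -> [/\ x0 = y0, x1 = y1 & x2 = y2].
Proof.
move=> [_ free_uv] /eqP; rewrite -subr_eq0 rat_combB => /eqP/free_uv[].
by move=> /eqP + /eqP + /eqP; rewrite !subr_eq0 => /eqP-> /eqP-> /eqP->.
Qed.

Lemma is_rational_basisC u v : is_rational_basis u v -> is_rational_basis v u.
Proof.
move=> [gen_uv free_uv]; split=> [x|x0 x1 x2].
  by have [x0 [x1 [x2 ->]]] := gen_uv x; exists x0, x2, x1; rewrite rat_combC.
by rewrite rat_combC => /free_uv[].
Qed.

Lemma is_rational_basis_scale u v (p q : rat) : p != 0 -> q != 0 ->
  is_rational_basis u v -> is_rational_basis (in_alg K p * u) (in_alg K q * v).
Proof.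
move=> p_neq0 q_neq0 [gen_uv free_uv].
have scaleE x0 x1 x2 : rat_comb (in_alg K p * u) (in_alg K q * v) x0 x1 x2 =
    rat_comb u v x0 (x1 * p) (x2 * q).
  by rewrite /rat_comb !rmorphM /= !mulrA.
split=> [x|x0 x1 x2].
  have [x0 [x1 [x2 ->]]] := gen_uv x; exists x0, (x1 / p), (x2 / q).
  by rewrite scaleE !divfK.
rewrite scaleE => /free_uv[-> /eqP + /eqP].
by rewrite !mulf_eq0 (negPf p_neq0) (negPf q_neq0) !orbF => /eqP-> /eqP->.
Qed.

Lemma dim_rational_basis u v : is_rational_basis u v -> \dim {:K} = 3%N.
Proof.
move=> [gen_uv free_uv].
have combE x0 x1 x2 : rat_comb u v x0 x1 x2 = x0 *: 1 + (x1 *: u + x2 *: v).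
  by rewrite /rat_comb /= !mulr_algl addrA.
pose e := [tuple 1; u; v].
have free_e : free e.
  apply/freeP => k; rewrite !big_ord_recl big_ord0 /= addr0 -combE => /free_uv[k0 k1 k2].
  by case=> -[|[|[|//]]] lt_i3; [rewrite -[RHS]k0|rewrite -[RHS]k1|rewrite -[RHS]k2];
    congr k; apply/val_inj.
suff span_full : {:K}%VS = <<e>>%VS.
  by rewrite span_full; apply/eqP; move: free_e; rewrite /free.
apply/eqP; rewrite eq_sym eqEsubv subvf /=; apply/subvP => x _.
have [x0 [x1 [x2 ->]]] := gen_uv x; rewrite combE.
by rewrite !rpredD// rpredZ// memv_span// !inE eqxx ?orbT.
Qed.

Lemma rmorph_in_alg (F : numFieldType) (phi : {rmorphism K -> F}) (q : rat) :
  phi (in_alg K q) = ratr q.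
Proof. by rewrite -(fmorph_eq_rat (phi \o in_alg K)). Qed.

Lemma rmorph_rat_comb (F : numFieldType) (phi : {rmorphism K -> F}) u v x0 x1 x2 :
  phi (rat_comb u v x0 x1 x2) = ratr x0 + ratr x1 * phi u + ratr x2 * phi v.
Proof. by rewrite /rat_comb !rmorphD !rmorphM !rmorph_in_alg. Qed.

Lemma cube_root_basis (m : rat) (g : K) :
  (forall q : rat, q ^+ 3 <> m) -> g ^+ 3 = m%:A -> <<1; g>>%VS = {:K}%VS ->
  is_rational_basis g (g ^+ 2).
Proof.
move=> not_cube g_cube gen_g; pose p : {poly rat} := 'X^3 - m%:P.
have size_p : size p = 4%N by rewrite size_XnsubC.
have irr_p : irreducible_poly p.
  apply: cubic_irreducible => [|x]; first by rewrite size_p.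
  by apply/negP; rewrite /root !hornerE subr_eq0 => /eqP/not_cube.
have root_p : root (map_poly (in_alg K) p) g.
  by rewrite /root rmorphB /= map_polyXn map_polyC /= !hornerE g_cube subrr.
have evalE (q : {poly rat}) : (size q <= 3)%N ->
    (map_poly (in_alg K) q).[g] = rat_comb g (g ^+ 2) q`_0 q`_1 q`_2.
  move=> size_q; rewrite (horner_coef_wide (n := 3)) ?size_map_poly//.
  by rewrite !big_ord_recr big_ord0 /= !coef_map /= add0r expr0 mulr1 expr1.
split=> [x|x0 x1 x2].
  have : x \in <<1; g>>%VS by rewrite gen_g memvf.
  case/Fadjoin_polyP => r /polyOver1P[q ->] ->.
  have -> : (map_poly (in_alg K) q).[g] = (map_poly (in_alg K) (q %% p)).[g].
    by rewrite {1}(divp_eq q p) rmorphD rmorphM /= !hornerE (rootP root_p) mulr0 add0r.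
  by rewrite evalE; [do 3 eexists | rewrite -ltnS -size_p ltn_modp -size_poly_eq0 size_p].
pose q := Poly [:: x0; x1; x2].
have size_q : (size q <= 3)%N by apply: leq_trans (size_Poly _) _.
have -> : rat_comb g (g ^+ 2) x0 x1 x2 = (map_poly (in_alg K) q).[g].
  by rewrite evalE// !coef_Poly.
move=> q_g0; suff q0 : q = 0.
  by split; [have := coef_Poly [:: x0; x1; x2] 0|have := coef_Poly [:: x0; x1; x2] 1
    |have := coef_Poly [:: x0; x1; x2] 2]; rewrite -/q q0 coef0.
apply/eqP; apply: contraT => q_neq0.
have : ~~ (p %| q) by apply: contraL size_q => /(dvdp_leq q_neq0); rewrite size_p -ltnNge.
rewrite -irreducible_poly_coprime// -(coprimep_map (in_alg K)).
by move=> /coprimep_root/(_ root_p); rewrite q_g0 eqxx.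
Qed.

End RationalBasis.

(** * Pure cubic fields *)

Definition pure_relations (A : comPzRingType) (a b : nat) (r s : A) : Prop :=
  [/\ r * r = b%:R * s, s * s = a%:R * r & r * s = a%:R * b%:R].

Definition pure_radicand (a b : nat) : int := a%:Z * b%:Z ^+ 2.

Lemma pure_radicandE (A : pzRingType) (a b : nat) :
  (pure_radicand a b)%:~R = a%:R * b%:R ^+ 2 :> A.
Proof. by rewrite rmorphM rmorphXn. Qed.

Section PureRelations.
Variables a b : nat.

Lemma pure_relationsC (A : comPzRingType) (r s : A) :
  pure_relations a b r s -> pure_relations b a s r.
Proof. by move=> [rr ss rs]; split=> //; rewrite mulrC rs mulrC. Qed.

Lemma pure_relations_cube (A : comPzRingType) (r s : A) :
  pure_relations a b r s -> r ^+ 3 = a%:R * b%:R ^+ 2.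
Proof. by move=> [rr _ rs]; rewrite exprS expr2 rr mulrCA rs; ring. Qed.

Lemma pure_relations_twist (A : comPzRingType) (r s w : A) : w ^+ 3 = 1 ->
  pure_relations a b r s -> pure_relations a b (w * r) (w ^+ 2 * s).
Proof.
move=> w_cube [rr ss rs]; split.
- by transitivity (w ^+ 2 * (r * r)); [ring | rewrite rr; ring].
- by transitivity (w ^+ 3 * w * (s * s)); [ring | rewrite w_cube ss; ring].
- by transitivity (w ^+ 3 * (r * s)); [ring | rewrite w_cube rs mul1r].
Qed.

Lemma cube_root_relations (F : fieldType) (r : F) : b%:R != 0 :> F ->
  r ^+ 3 = a%:R * b%:R ^+ 2 -> pure_relations a b r (r ^+ 2 / b%:R).
Proof.
move=> b_neq0 r_cube; split.
- by field.
- by transitivity (r ^+ 3 * r / b%:R ^+ 2); [field | rewrite r_cube; field].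
- by transitivity (r ^+ 3 / b%:R); [field | rewrite r_cube; field].
Qed.

End PureRelations.

(* Keeping both cube roots [al] of [a b^2] and [be] of [a^2 b], instead of a
   single generator, makes the roles of [a] and [b] symmetric. *)
Record pure_pair (K : fieldExtType rat) (a b : nat) (al be : K) : Prop := PurePair {
  pure_squarefree_l : power_free 2 a;
  pure_squarefree_r : power_free 2 b;
  pure_coprime : coprime a b;
  pure_pair_relations : pure_relations a b al be;
  pure_basis : is_rational_basis al be }.

Lemma pure_pairC (K : fieldExtType rat) (a b : nat) (al be : K) :
  pure_pair a b al be -> pure_pair b a be al.
Proof.
move=> [a_free b_free cop_ab rel basis]; split=> //.
- by rewrite coprime_sym.
- exact: pure_relationsC.
- exact: is_rational_basisC.
Qed.

Lemma pure_pair_dvd3 (K : fieldExtType rat) (a b : nat) (al be : K) :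
  pure_pair a b al be -> (3 %| a)%N -> ~~ (3 %| b)%N.
Proof.
move=> pure_ab a_dvd; rewrite -prime_coprime//.
exact: coprime_dvdl a_dvd (pure_coprime pure_ab).
Qed.

Lemma rat_cube_free_part (m : rat) : m != 0 ->
  exists (q : rat) (n : nat), [/\ q != 0, power_free 3 n & q ^+ 3 * m = n%:R].
Proof.
move=> m_neq0; pose d : rat := (denq m)%:~R.
have d_neq0 : d != 0 by rewrite intr_eq0 denq_neq0.
pose N := absz (numq m * denq m ^+ 2).
have N_eq : N%:R = `|m * d ^+ 3|.
  by rewrite natr_absz intr_norm rmorphM rmorphXn /= -/d numqE -/d; congr `|_|; ring.
have N_gt0 : (0 < N)%N by rewrite -(ltr0n rat) N_eq normr_gt0 mulf_neq0// expf_neq0.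
have [c [n [c_gt0 N_split n_free]]] := power_free_part (isT : 0 < 3)%N N_gt0.
have c_neq0 : c%:R != 0 :> rat by rewrite pnatr_eq0 -lt0n.
pose e : rat := (-1) ^+ (m * d ^+ 3 < 0)%R.
exists (e * d / c%:R), n; split=> //.
  by rewrite !mulf_neq0 ?invr_eq0// signr_eq0.
have e_sqr : e ^+ 2 = 1 by rewrite sqrr_sign.
transitivity (e ^+ 2 * (e * (m * d ^+ 3)) / c%:R ^+ 3); first by field.
by rewrite e_sqr mul1r -normrEsign -N_eq N_split natrM natrX
  mulrAC divff ?mul1r// expf_neq0.
Qed.

Lemma pure_pair_exists (K : fieldExtType rat) : is_pure_cubic K ->
  exists a b (al be : K), pure_pair a b al be.
Proof.
move=> [m [not_cube [g [g_cube gen_g]]]].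
have m_neq0 : m != 0 by apply/eqP => m0; apply: (not_cube 0); rewrite m0 expr0n.
have [q [n [q_neq0 n_free n_eq]]] := rat_cube_free_part m_neq0.
have [a [b [n_split a_free b_free cop_ab]]] := cube_free_split n_free.
have b_neq0 : b%:R != 0 :> rat := power_free_natr_neq0 rat b_free.
have bK : in_alg K b%:R = b%:R by rewrite rmorph_nat.
pose al := in_alg K q * g; exists a, b, al, (al ^+ 2 / b%:R); split=> //.
  apply: cube_root_relations; first by rewrite -bK fmorph_eq0.
  rewrite exprMn g_cube -[m%:A]/(in_alg K m) -rmorphXn -rmorphM n_eq n_split.
  by rewrite rmorph_nat natrM natrX.
have -> : al ^+ 2 / b%:R = in_alg K (q ^+ 2 / b%:R) * g ^+ 2.
  by rewrite /al -bK exprMn rmorphM fmorphV rmorphXn mulrAC.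
apply: is_rational_basis_scale (cube_root_basis not_cube g_cube gen_g) => //.
by rewrite mulf_neq0 ?expf_neq0// invr_eq0.
Qed.

Section PurePair.
Variables (K : fieldExtType rat) (a b : nat) (al be : K).
Hypothesis pure_ab : pure_pair a b al be.
Local Notation comb := (rat_comb al be).

Lemma rat_combM x0 x1 x2 y0 y1 y2 :
  comb x0 x1 x2 * comb y0 y1 y2 =
  comb (x0 * y0 + a%:R * b%:R * (x1 * y2 + x2 * y1))
    (x0 * y1 + x1 * y0 + a%:R * (x2 * y2)) (x0 * y2 + x2 * y0 + b%:R * (x1 * y1)).
Proof.
have [alal bebe albe] := pure_pair_relations pure_ab.
rewrite /rat_comb; set A := in_alg K.
transitivity (A x0 * A y0 + (A x1 * A y2 + A x2 * A y1) * (al * be) +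
   (A x1 * A y1) * (al * al) + (A x2 * A y2) * (be * be) +
   (A x0 * A y1 + A x1 * A y0) * al + (A x0 * A y2 + A x2 * A y0) * be); first by ring.
by rewrite albe alal bebe /A; ring.
Qed.

Lemma pure_rmorph (F : numFieldType) (r s : F) : pure_relations a b r s ->
  exists phi : {rmorphism K -> F}, phi al = r /\ phi be = s.
Proof.
move=> [rr ss rs]; have basis := pure_basis pure_ab.
have /choice[c cE] : forall x, exists c : rat * rat * rat, x = comb c.1.1 c.1.2 c.2.
  by move=> x; have [x0 [x1 [x2 ->]]] := basis.1 x; exists (x0, x1, x2).
pose f x : F := ratr (c x).1.1 + ratr (c x).1.2 * r + ratr (c x).2 * s.
have fE x0 x1 x2 : f (comb x0 x1 x2) = ratr x0 + ratr x1 * r + ratr x2 * s.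
  by rewrite /f; have [<- <- <-] := rat_comb_inj basis (cE (comb x0 x1 x2)).
have fB : zmod_morphism f.
  move=> x y; have [x0 [x1 [x2 ->]]] := basis.1 x; have [y0 [y1 [y2 ->]]] := basis.1 y.
  by rewrite rat_combB !fE; ring.
have fM : monoid_morphism f.
  split.
    have -> : 1 = comb 1 0 0 by rewrite -rat_comb_alg rmorph1.
    by rewrite fE rmorph1 rmorph0; ring.
  move=> x y; have [x0 [x1 [x2 ->]]] := basis.1 x; have [y0 [y1 [y2 ->]]] := basis.1 y.
  rewrite rat_combM !fE; set A : {rmorphism rat -> F} := ratr.
  transitivity (A x0 * A y0 + (A x1 * A y2 + A x2 * A y1) * (r * s) +
     (A x1 * A y1) * (r * r) + (A x2 * A y2) * (s * s) +
     (A x0 * A y1 + A x1 * A y0) * r + (A x0 * A y2 + A x2 * A y0) * s); last by ring.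
  by rewrite rs rr ss !(rmorphD, rmorphM, rmorph_nat) /=; ring.
pose phi : {rmorphism K -> F} := HB.pack f
  (GRing.isZmodMorphism.Build K F f fB) (GRing.isMonoidMorphism.Build K F f fM).
exists phi; rewrite /phi /=; split.
  by rewrite [X in f X](rat_comb_fst al be) fE rmorph1 rmorph0; ring.
by rewrite [X in f X](rat_comb_snd al be) fE rmorph1 rmorph0; ring.
Qed.

Lemma pure_rmorph_family (F : numFieldType) (r s z : F) :
  pure_relations a b r s -> z ^+ 3 = 1 ->
  exists sigma : 'I_3 -> {rmorphism K -> F},
    forall i, sigma i al = z ^+ i * r /\ sigma i be = z ^+ (2 * i) * s.
Proof.
move=> rel z_cube.
suff /choice[sigma sigmaE] : forall i : 'I_3, exists phi : {rmorphism K -> F},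
    phi al = z ^+ i * r /\ phi be = z ^+ (2 * i) * s by exists sigma.
move=> i; rewrite mulnC exprM; apply/pure_rmorph/pure_relations_twist => //.
by rewrite exprAC z_cube expr1n.
Qed.

Lemma pure_algC_embeddings :
  exists (r s z : algC) (sigma : 'I_3 -> {rmorphism K -> algC}),
    [/\ pure_relations a b r s, 3.-primitive_root z &
        forall i, sigma i al = z ^+ i * r /\ sigma i be = z ^+ (2 * i) * s].
Proof.
have b_neq0 := power_free_natr_neq0 algC (pure_squarefree_r pure_ab).
pose r : algC := 3.-root (a%:R * b%:R ^+ 2).
have [z z_prim] := C_prim_root_exists (isT : 0 < 3)%N.
have rel : pure_relations a b r (r ^+ 2 / b%:R).
  by apply: cube_root_relations => //; rewrite rootCK.
have [sigma sigmaE] := pure_rmorph_family rel (prim_expr_order z_prim).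
by exists r, (r ^+ 2 / b%:R), z, sigma.
Qed.

Lemma pure_rmorph_ext (F : numFieldType) (phi psi : {rmorphism K -> F}) :
  phi al = psi al -> phi = psi :> (K -> F).
Proof.
move=> eq_al; have [alal _ _] := pure_pair_relations pure_ab.
have b_neq0 := power_free_natr_neq0 F (pure_squarefree_r pure_ab).
have beE (chi : {rmorphism K -> F}) : b%:R * chi be = chi al * chi al.
  by rewrite -rmorphM alal rmorphM rmorph_nat.
apply: funext => x; have [x0 [x1 [x2 ->]]] := (pure_basis pure_ab).1 x.
rewrite !rmorph_rat_comb eq_al; congr (_ + _ * _).
by apply: (mulfI b_neq0); rewrite !beE eq_al.
Qed.

End PurePair.

Lemma prim_root3_sqr (F : fieldType) (z : F) : 3.-primitive_root z -> z ^+ 2 = - z - 1.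
Proof.
move=> z_prim; have z_neq1 : z - 1 != 0.
  by rewrite subr_eq0 -[z]expr1 -[1](expr0 z) (eq_prim_root_expr z_prim).
apply: (mulfI z_neq1).
by transitivity (z ^+ 3 - 1 - (z ^+ 2 - 1));
  [ring | rewrite (prim_expr_order z_prim); ring].
Qed.

Section PureConjugates.
Variables (K : fieldExtType rat) (a b : nat) (al be : K).
Variables (F : numFieldType) (r s z : F) (sigma : 'I_3 -> {rmorphism K -> F}).
Hypotheses (rel : pure_relations a b r s) (z_prim : 3.-primitive_root z).
Hypothesis sigmaE : forall i, sigma i al = z ^+ i * r /\ sigma i be = z ^+ (2 * i) * s.
Variables x0 x1 x2 : rat.
Local Notation x := (rat_comb al be x0 x1 x2).

Let A : {rmorphism rat -> F} := @ratr F.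
Let U : F := A x1 * r.
Let V : F := A x2 * s.

Lemma pure_conjugates :
  [/\ sigma 0 x = A x0 + U + V, sigma 1 x = A x0 + z * U + (- z - 1) * V &
      sigma 2 x = A x0 + (- z - 1) * U + z * V].
Proof.
have z_pow4 : z ^+ 4 = z by rewrite exprS (prim_expr_order z_prim) mulr1.
rewrite !rmorph_rat_comb !(sigmaE _).1 !(sigmaE _).2 /=.
by split; rewrite ?z_pow4 ?expr1 ?(prim_root3_sqr z_prim) /U /V; ring.
Qed.

Lemma pure_conjugates_mul : U * V = A (a%:R * b%:R * x1 * x2).
Proof.
have [_ _ rs] := rel; transitivity (r * s * A x1 * A x2); first by rewrite /U /V; ring.
by rewrite rs !(rmorphM, rmorph_nat).
Qed.

Lemma pure_conjugates_cube :
  U ^+ 3 = A (a%:R * b%:R ^+ 2 * x1 ^+ 3) /\ V ^+ 3 = A (a%:R ^+ 2 * b%:R * x2 ^+ 3).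
Proof.
have relC := pure_relationsC rel.
by split; rewrite exprMn ?(pure_relations_cube rel) ?(pure_relations_cube relC); ring.
Qed.

Lemma pure_conjugates_sum : sigma 0 x + sigma 1 x + sigma 2 x = A (3 * x0).
Proof. by have [-> -> ->] := pure_conjugates; ring. Qed.

Lemma pure_conjugates_minor :
  sigma 0 x * sigma 1 x + sigma 0 x * sigma 2 x + sigma 1 x * sigma 2 x =
  A (3 * pure_minor a%:R b%:R x0 x1 x2).
Proof.
have [-> -> ->] := pure_conjugates.
transitivity (3 * (A x0 ^+ 2 - U * V) - (z ^+ 2 + z + 1) * (U - V) ^+ 2); first by ring.
rewrite (prim_root3_sqr z_prim) pure_conjugates_mul /pure_minor.
by ring.
Qed.

Lemma pure_conjugates_prod :
  sigma 0 x * sigma 1 x * sigma 2 x = A (pure_norm a%:R b%:R x0 x1 x2).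
Proof.
have [-> -> ->] := pure_conjugates; have [U_cube V_cube] := pure_conjugates_cube.
transitivity (A x0 ^+ 3 + U ^+ 3 + V ^+ 3 - 3 * A x0 * (U * V)
    - (z ^+ 2 + z + 1) * ((A x0 + U + V) * (U - V) ^+ 2)); first by ring.
rewrite (prim_root3_sqr z_prim) pure_conjugates_mul U_cube V_cube /pure_norm.
by ring.
Qed.

End PureConjugates.

(** * Integers of a pure cubic field *)

Section PureIntegers.
Variables (K : fieldExtType rat) (a b : nat) (al be : K).
Hypothesis pure_ab : pure_pair a b al be.
Local Notation comb := (rat_comb al be).

Lemma pure_char_poly x0 x1 x2 (x := comb x0 x1 x2) :
  x ^+ 3 - in_alg K (3 * x0) * x ^+ 2
    + in_alg K (3 * pure_minor a%:R b%:R x0 x1 x2) * x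
    - in_alg K (pure_norm a%:R b%:R x0 x1 x2) = 0.
Proof.
rewrite exprS expr2 /x [in_alg K (pure_norm _ _ _ _ _)](rat_comb_alg al be).
rewrite !(rat_combM pure_ab, rat_combZ, rat_combB, rat_combD).
rewrite -[RHS](rmorph0 (in_alg K)) [RHS](rat_comb_alg al be) /pure_norm /pure_minor.
by congr rat_comb; ring.
Qed.

Lemma pure_integralP (x0 x1 x2 : rat) : ring_of_integers (comb x0 x1 x2) <->
  [/\ (3 * x0 : rat) \is a Num.int,
      (3 * pure_minor a%:R b%:R x0 x1 x2 : rat) \is a Num.int &
      (pure_norm a%:R b%:R x0 x1 x2 : rat) \is a Num.int].
Proof.
split=> [Ox|[/intrP[e1 e1_eq] /intrP[e2 e2_eq] /intrP[e3 e3_eq]]]; last first.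
  apply: (@ring_of_integers_cubic _ _ e1 e2 e3).
  by rewrite -!(rmorph_int (in_alg K)) -e1_eq -e2_eq -e3_eq pure_char_poly.
have [r [s [z [sigma [rel z_prim sigmaE]]]]] := pure_algC_embeddings pure_ab.
have Osigma i := ring_of_integers_rmorph (sigma i) Ox.
split; apply: (@integral_rat_is_int _ (@ratr algC)).
- rewrite -(pure_conjugates_sum z_prim sigmaE x0 x1 x2).
  by do 2?[apply: integral_add].
- rewrite -(pure_conjugates_minor rel z_prim sigmaE x0 x1 x2).
  by do 2?[apply: integral_add]; apply: integral_mul.
- rewrite -(pure_conjugates_prod rel z_prim sigmaE x0 x1 x2).
  by do 2?[apply: integral_mul].
Qed.

Lemma ring_of_integers_pure : ring_of_integers al.
Proof.
rewrite (rat_comb_fst al be) pure_integralP /pure_norm /pure_minor.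
by rewrite !(mulr0, mulr1, expr0n, expr1n, add0r, subr0, addr0)
  !(rpred0, rpredM, rpredX, rpred_nat).
Qed.

End PureIntegers.

Section PureDenominator.
Variables (K : fieldExtType rat) (a b : nat) (al be : K).
Hypothesis pure_ab : pure_pair a b al be.
Local Notation comb := (rat_comb al be).

Lemma ring_of_integers_int_comb (n0 n1 n2 : int) :
  ring_of_integers (comb n0%:~R n1%:~R n2%:~R).
Proof.
have Oal := ring_of_integers_pure pure_ab.
have Obe := ring_of_integers_pure (pure_pairC pure_ab).
by rewrite rat_comb_intr -[al *~ _]mulrzl -[be *~ _]mulrzl; integral.
Qed.

Lemma pure_denominator_fst (x0 x1 x2 : rat) :
  ring_of_integers (comb x0 x1 x2) -> 3 * x1 \is a Num.int.
Proof.
move=> Ox; have Oal := ring_of_integers_pure pure_ab.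
have Obe := ring_of_integers_pure (pure_pairC pure_ab).
have [a_free b_free cop_ab _ _] := pure_ab.
have a_neq0 := power_free_natr_neq0 rat a_free.
have b_neq0 := power_free_natr_neq0 rat b_free.
have [/intrP[n n_eq] _ _] := (pure_integralP pure_ab _ _ _).1 Ox.
have := ring_of_integersM Ox Obe.
rewrite [X in _ * X](rat_comb_snd al be) (rat_combM pure_ab).
move=> /(pure_integralP pure_ab)[/intrP[c c_eq] _ _].
have := ring_of_integersM Ox Oal.
rewrite [X in _ * X](rat_comb_fst al be) (rat_combM pure_ab).
move=> /(pure_integralP pure_ab)[/intrP[d d_eq] _ _].
have x1E : 3 * x1 = c%:~R / (a%:Z * b%:Z)%:~R.
  by rewrite -c_eq rmorphM /= -!pmulrn; field; rewrite a_neq0 b_neq0.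
have x2E : 3 * x2 = d%:~R / (a%:Z * b%:Z)%:~R.
  by rewrite -d_eq rmorphM /= -!pmulrn; field; rewrite a_neq0 b_neq0.
have ab_neq0 : a%:Z * b%:Z != 0.
  by rewrite mulf_neq0// -lt0n (power_free_gt0 a_free, power_free_gt0 b_free).
rewrite x1E intr_div_is_int//;
  apply: (squarefree_dvdz_cube_sum (d := d) a_free b_free cop_ab).
rewrite -intr_div_is_int ?sqrf_eq0//.
have : ring_of_integers (comb 0 (3 * x1) (3 * x2)).
  have -> : comb 0 (3 * x1) (3 * x2) = 3%:R * comb x0 x1 x2 - n%:~R.
    have -> : n%:~R = in_alg K (3 * x0) by rewrite n_eq rmorph_int.
    by rewrite /rat_comb rmorph0; ring.
  by integral.
move=> /(pure_integralP pure_ab)[_ _]; rewrite x1E x2E /pure_norm.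
rewrite !(rmorphD, rmorphM, rmorphXn) /= -!pmulrn.
by congr (_ \is a Num.int); field; rewrite a_neq0 b_neq0.
Qed.

End PureDenominator.

(** * Denominators 3 and tame radicands *)

Definition third_comb (K : fieldExtType rat) (u v : K) (y0 y1 y2 : int) : K :=
  rat_comb u v (y0%:~R / 3) (y1%:~R / 3) (y2%:~R / 3).

Lemma third_combC (K : fieldExtType rat) (u v : K) (y0 y1 y2 : int) :
  third_comb u v y0 y1 y2 = third_comb v u y0 y2 y1.
Proof. exact: rat_combC. Qed.

Lemma third_comb_dvd3 (K : fieldExtType rat) (u v : K) (y0 y1 y2 : int) :
  (3 %| y0)%Z -> (3 %| y1)%Z -> (3 %| y2)%Z ->
  exists n0 n1 n2 : int, third_comb u v y0 y1 y2 = rat_comb u v n0%:~R n1%:~R n2%:~R.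
Proof.
move=> /dvdzP[n0 ->] /dvdzP[n1 ->] /dvdzP[n2 ->]; exists n0, n1, n2.
by rewrite /third_comb !rmorphM /=; congr rat_comb; field.
Qed.

Definition tame_radicand (a b : nat) : bool := (9 %| pure_radicand a b ^+ 2 - 1)%Z.

(* The number (1 + m al + al^2) / 3, where m = a b^2 and al^2 = b be. *)
Definition tame_elt (K : fieldExtType rat) (a b : nat) (al be : K) : K :=
  third_comb al be 1 (pure_radicand a b) b.

Lemma tame_radicand_ndvd3 (a b : nat) :
  tame_radicand a b -> ~~ (3 %| pure_radicand a b)%Z.
Proof.
move=> tame_ab; apply/negP => /dvdzP[k m_eq]; have /dvdzP[l] := tame_ab.
by rewrite m_eq; lia.
Qed.

Lemma tame_factors_ndvd3 (a b : nat) :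
  tame_radicand a b -> ~~ (3 %| a)%N /\ ~~ (3 %| b)%N.
Proof.
move=> /tame_radicand_ndvd3; rewrite /pure_radicand.
by rewrite (@Euclid_dvdzM 3)// (@Euclid_dvdzX 3)// andbT negb_or => /andP.
Qed.

Section PureThirds.
Variables (K : fieldExtType rat) (a b : nat) (al be : K).
Hypothesis pure_ab : pure_pair a b al be.
Local Notation m := (pure_radicand a b).
Local Notation third := (third_comb al be).

Lemma pure_thirds (x : K) : ring_of_integers x ->
  exists y0 y1 y2 : int, x = third y0 y1 y2.
Proof.
have [x0 [x1 [x2 ->]]] := (pure_basis pure_ab).1 x => Ox.
have [/intrP[y0 y0_eq] _ _] := (pure_integralP pure_ab _ _ _).1 Ox.
have /intrP[y1 y1_eq] := pure_denominator_fst pure_ab Ox.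
have /intrP[y2 y2_eq] : 3 * x2 \is a Num.int.
  by rewrite rat_combC in Ox; apply: pure_denominator_fst (pure_pairC pure_ab) _ _ _ Ox.
by exists y0, y1, y2; rewrite /third_comb -y0_eq -y1_eq -y2_eq; congr rat_comb; field.
Qed.

Lemma third_integralP (y0 y1 y2 : int) : ring_of_integers (third y0 y1 y2) <->
  (3 %| pure_minor a%:Z b%:Z y0 y1 y2)%Z /\ (27 %| pure_norm a%:Z b%:Z y0 y1 y2)%Z.
Proof.
have minorE : 3 * pure_minor a%:R b%:R (y0%:~R / 3) (y1%:~R / 3) (y2%:~R / 3) =
    (pure_minor a%:Z b%:Z y0 y1 y2)%:~R / 3%:~R :> rat.
  by rewrite /pure_minor !(rmorphB, rmorphM, rmorphXn) /= -!pmulrn; field.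
have normE : pure_norm a%:R b%:R (y0%:~R / 3) (y1%:~R / 3) (y2%:~R / 3) =
    (pure_norm a%:Z b%:Z y0 y1 y2)%:~R / 27%:~R :> rat.
  by rewrite /pure_norm !(rmorphB, rmorphD, rmorphM, rmorphXn) /= -!pmulrn; field.
rewrite (pure_integralP pure_ab) minorE normE !intr_div_is_int// mulrC divfK//.
by split=> [[]|[? ?]]; rewrite ?intr_int.
Qed.

Lemma pure_thirds_congr (y0 y1 y2 : int) : ~~ (3 %| a)%N -> ~~ (3 %| b)%N ->
  ring_of_integers (third y0 y1 y2) ->
  (3 %| y1 - a%:Z * y0)%Z /\ (3 %| y2 - b%:Z * y0)%Z.
Proof.
move=> a_ndvd b_ndvd /third_integralP[minor_dvd norm_dvd].
by apply: pure_norm_mod3 => //; apply: dvdz_trans norm_dvd.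
Qed.

Lemma pure_thirds_dvd_lead (y0 y1 y2 : int) : ~~ (3 %| a)%N -> ~~ (3 %| b)%N ->
  ring_of_integers (third y0 y1 y2) -> (3 %| y0)%Z -> (3 %| y1)%Z /\ (3 %| y2)%Z.
Proof.
move=> a_ndvd b_ndvd Oy y0_dvd.
have [y1_congr y2_congr] := pure_thirds_congr a_ndvd b_ndvd Oy.
split; first by rewrite -(subrK (a%:Z * y0) y1) rpredD// dvdz_mull.
by rewrite -(subrK (b%:Z * y0) y2) rpredD// dvdz_mull.
Qed.

Lemma pure_thirds_dvd3 (y0 y1 y2 : int) : (3 %| a)%N ->
  ring_of_integers (third y0 y1 y2) -> [/\ (3 %| y0)%Z, (3 %| y1)%Z & (3 %| y2)%Z].
Proof.
move=> a_dvd /third_integralP[_]; apply: pure_norm_dvd27 => //.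
  by apply/negP => /(pure_squarefree_l pure_ab (d := 3)).
exact: pure_pair_dvd3 pure_ab a_dvd.
Qed.

Lemma tame_elt_integralP : ring_of_integers (tame_elt a b al be) <-> tame_radicand a b.
Proof.
rewrite third_integralP /tame_radicand.
have -> : pure_norm a%:Z b%:Z 1 m b = (m ^+ 2 - 1) ^+ 2.
  by rewrite /pure_norm /pure_radicand; ring.
have -> : pure_minor a%:Z b%:Z 1 m b = - (m ^+ 2 - 1).
  by rewrite /pure_minor /pure_radicand; ring.
split=> [[_]|nine_dvd]; first exact: (@Euclid_dvdz_cube_sqr 3).
rewrite rpredN; split; first exact: dvdz_trans nine_dvd.
by apply: (@dvdz_trans (9 * 9)) => //; rewrite expr2 dvdz_mul.
Qed.

(* Modulo Z[al, be] such an element is [y0] times [tame_elt]. *)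
Lemma tame_of_thirds (y0 y1 y2 : int) : ~~ (3 %| a)%N -> ~~ (3 %| b)%N ->
  ring_of_integers (third y0 y1 y2) -> ~~ (3 %| y0)%Z -> tame_radicand a b.
Proof.
move=> a_ndvd b_ndvd Ox /(Fermat_dvdz (isT : prime 3)) y0_sqr.
have b_sqr := Fermat_dvdz (isT : prime 3) (b_ndvd : ~~ (3 %| b%:Z)%Z).
have [y1_congr y2_congr] := pure_thirds_congr a_ndvd b_ndvd Ox.
have [n0 [n1 [n2 comb_eq]]] : exists n0 n1 n2 : int,
    third (y0 ^+ 2 - 1) (y0 * y1 - m) (y0 * y2 - b%:Z) =
    rat_comb al be n0%:~R n1%:~R n2%:~R.
  apply: third_comb_dvd3 => //.
    have -> : y0 * y1 - m =
      y0 * (y1 - a%:Z * y0) + a%:Z * (y0 ^+ 2 - 1) - a%:Z * (b%:Z ^+ 2 - 1).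
      by rewrite /pure_radicand; ring.
    by rewrite rpredB ?rpredD ?dvdz_mull.
  have -> : y0 * y2 - b%:Z = y0 * (y2 - b%:Z * y0) + b%:Z * (y0 ^+ 2 - 1) by ring.
  by rewrite rpredD ?dvdz_mull.
apply/tame_elt_integralP.
have -> : tame_elt a b al be =
  y0%:~R * third y0 y1 y2 - rat_comb al be n0%:~R n1%:~R n2%:~R.
  rewrite -comb_eq -(rmorph_int (in_alg K)) /tame_elt /third_comb rat_combZ rat_combB.
  by rewrite !(rmorphB, rmorphM, rmorphXn) /=; congr rat_comb; field.
have := ring_of_integers_int_comb pure_ab n0 n1 n2 => On.
by integral.
Qed.

End PureThirds.

Lemma wild_integers (K : fieldExtType rat) (a b : nat) (al be x : K) :
  pure_pair a b al be -> ~~ tame_radicand a b -> ring_of_integers x ->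
  exists n0 n1 n2 : int, x = rat_comb al be n0%:~R n1%:~R n2%:~R.
Proof.
move=> pure_ab wild_ab Ox; have [y0 [y1 [y2 x_eq]]] := pure_thirds pure_ab Ox.
rewrite x_eq in Ox *.
suff [y0_dvd y1_dvd y2_dvd] : [/\ (3 %| y0)%Z, (3 %| y1)%Z & (3 %| y2)%Z].
  exact: third_comb_dvd3.
have [a_dvd|a_ndvd] := boolP (3 %| a)%N; first exact: (pure_thirds_dvd3 pure_ab a_dvd Ox).
have [b_dvd|b_ndvd] := boolP (3 %| b)%N.
  by rewrite third_combC in Ox; have [] := pure_thirds_dvd3 (pure_pairC pure_ab) b_dvd Ox.
have y0_dvd : (3 %| y0)%Z.
  by apply: contraNT wild_ab; apply: tame_of_thirds pure_ab _ _ _ a_ndvd b_ndvd Ox.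
by have [] := pure_thirds_dvd_lead pure_ab a_ndvd b_ndvd Ox y0_dvd.
Qed.

(** * Ramification at 3 *)

Section Ideals.
Variable K : fieldExtType rat.
Implicit Types (I J T P : set K) (p q x y : K).
Local Notation O := (@ring_of_integers K).

Lemma mem_ideal_mul I J x y : I x -> J y -> ideal_mul I J (x * y).
Proof.
by move=> Ix Jy; exists 1%N, (fun=> x), (fun=> y); split=> //; rewrite big_ord1.
Qed.

Lemma ideal_mulD I J x y :
  ideal_mul I J x -> ideal_mul I J y -> ideal_mul I J (x + y).
Proof.
move=> [n1 [u1 [v1 [mem1 ->]]]] [n2 [u2 [v2 [mem2 ->]]]].
exists (n1 + n2)%N,
  (fun i => match fintype.split i with inl j => u1 j | inr j => u2 j end),
  (fun i => match fintype.split i with inl j => v1 j | inr j => v2 j end).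
split; first by move=> i; case: (fintype.split i).
rewrite big_split_ord /=; congr (_ + _); apply: eq_bigr => i _.
  by rewrite (unsplitK (inl i)).
by rewrite (unsplitK (inr i)).
Qed.

Lemma ideal_mul_sub I J T : T 0 -> (forall x y, T x -> T y -> T (x + y)) ->
  (forall x y, I x -> J y -> T (x * y)) -> ideal_mul I J `<=` T.
Proof.
move=> T0 TD TM x [n [u [v [mem ->]]]].
by elim/big_ind: _ => // i _; apply: TM; case: (mem i).
Qed.

Definition principal_ideal q : set K := [set q * x | x in O].

Lemma principal_idealD q x y :
  principal_ideal q x -> principal_ideal q y -> principal_ideal q (x + y).
Proof.
by move=> [x' Ox' <-] [y' Oy' <-]; exists (x' + y'); [integral | rewrite mulrDr].
Qed.

Lemma principal_idealMl q x y :
  O x -> principal_ideal q y -> principal_ideal q (x * y).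
Proof. by move=> Ox [y' Oy' <-]; exists (x * y'); [integral | rewrite mulrCA]. Qed.

Lemma principal_ideal0 q : principal_ideal q 0.
Proof. by exists 0; [exact: (ring_of_integers_nat K 0) | rewrite mulr0]. Qed.

Definition ideal_pair p q : set K :=
  [set x | exists s t, [/\ O s, O t & x = p * s + q * t]].

Lemma ideal_pair_is_ideal p q : O p -> O q -> is_ideal (ideal_pair p q).
Proof.
move=> Op Oq; have O0 : O 0 := ring_of_integers_nat K 0; split.
- by move=> x [s [t [Os Ot ->]]]; rewrite /mkset; integral.
- by exists 0, 0; split=> //; ring.
- move=> x y [s [t [Os Ot ->]]] [s' [t' [Os' Ot' ->]]].
  by exists (s + s'), (t + t'); split; [integral | integral | ring].
- move=> x y Ox [s [t [Os Ot ->]]].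
  by exists (x * s), (x * t); split; [integral | integral | ring].
Qed.

Lemma mem_ideal_pair_l p q x : O x -> ideal_pair p q (p * x).
Proof.
by move=> Ox; exists x, 0; split=> //; [exact: (ring_of_integers_nat K 0) | ring].
Qed.

Lemma mem_ideal_pair_r p q x : O x -> ideal_pair p q (q * x).
Proof.
by move=> Ox; exists 0, x; split=> //; [exact: (ring_of_integers_nat K 0) | ring].
Qed.

Lemma ideal_pair_cube_sub p q v : O p -> O q -> O v -> p ^+ 3 = q * v ->
  let P := ideal_pair p q in ideal_mul (ideal_mul P P) P `<=` principal_ideal q.
Proof.
move=> Op Oq Ov p_cube P; have qD := @principal_idealD q; have q0 := principal_ideal0 q.
apply: ideal_mul_sub => // x _ PPx [s3 [t3 [Os3 Ot3 ->]]].
move: x PPx;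
  apply: (ideal_mul_sub (T := fun x => principal_ideal q (x * (p * s3 + q * t3)))).
- by rewrite mul0r.
- by move=> x y; rewrite mulrDl; apply: qD.
move=> _ _ [s1 [t1 [Os1 Ot1 ->]]] [s2 [t2 [Os2 Ot2 ->]]].
exists (v * s1 * s2 * s3 + p ^+ 2 * (s1 * s2 * t3 + s1 * t2 * s3 + t1 * s2 * s3)
  + q * p * (s1 * t2 * t3 + t1 * s2 * t3 + t1 * t2 * s3) + q ^+ 2 * t1 * t2 * t3).
  by integral.
by rewrite !mulrDr !mulrA -p_cube; ring.
Qed.

Lemma natr_not_unit (n : nat) x : (1 < n)%N -> O x -> n%:R * x <> 1.
Proof.
move=> n_gt1 Ox nx1; have n_neq0 : n%:R != 0 :> rat by rewrite pnatr_eq0 -lt0n ltnW.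
have x_eq : in_alg K n%:R^-1 = x.
  apply: (mulfI (_ : in_alg K n%:R != 0)); first by rewrite fmorph_eq0.
  by rewrite -rmorphM divff// rmorph1 rmorph_nat nx1.
have : 1%:~R / n%:~R \is a @Num.int rat.
  by rewrite mul1r; apply: (@ring_of_integers_rat K); rewrite x_eq.
by rewrite intr_div_is_int ?dvdz1; lia.
Qed.

Lemma prime_ideal_of_residue (l : nat) P : prime l -> is_ideal P -> ~ P 1 -> P l%:R ->
  (forall x, O x -> exists i : int, P (x - i%:~R)) -> is_prime_ideal P.
Proof.
move=> l_prime idealP P1 Pl residue; have [PO P0 PD PM] := idealP.
have P_dvd (i : int) : (l %| i)%Z -> P i%:~R.
  by move=> /dvdzP[k ->]; rewrite rmorphM; apply: PM => //; integral.
have dvd_P (i : int) : P i%:~R -> (l %| i)%Z.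
  move=> Pi; apply: contra_notT P1 => l_ndvd.
  have /coprimezP[[u v] /= bezout] : coprimez l i by rewrite coprimezE prime_coprime.
  rewrite -[1]/(1%:~R) -bezout rmorphD !rmorphM.
  by apply: PD; apply: (PM) => //; integral.
have P_residue x (i : int) : P (x - i%:~R) -> (l %| i)%Z -> P x.
  by move=> Pxi /P_dvd Pi; rewrite -(subrK i%:~R x); apply: PD.
split=> // x y Ox Oy Pxy.
have [i Pxi] := residue x Ox; have [j Pyj] := residue y Oy.
have : (l %| i * j)%Z.
  apply: dvd_P; have -> : (i * j)%:~R = x * y + - x * (y - j%:~R) + - j%:~R * (x - i%:~R).
    by rewrite rmorphM /=; ring.
  by apply: (PD); [apply: (PD) => // |]; apply: (PM) => //; integral.
rewrite Euclid_dvdzM// => /orP[/(P_residue _ _ Pxi)|/(P_residue _ _ Pyj)]; first by left.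
by right.
Qed.

Lemma wildly_ramified_of_uniformizer p w (c : int) :
  O p -> O w -> ~~ (3 %| c)%Z -> p ^+ 3 = 3 * (c%:~R + p * w) ->
  (forall x, O x -> exists i : int, ideal_pair p 3 (x - i%:~R)) ->
  wildly_ramified_at_3 K.
Proof.
move=> Op Ow c_ndvd p_cube residue; have O3 : O 3 := ring_of_integers_nat K 3.
have O1 : O 1 := ring_of_integers_nat K 1.
have Ov : O (c%:~R + p * w) by integral.
have Pp : ideal_pair p 3 p by rewrite -[X in _ X]mulr1; apply: mem_ideal_pair_l.
have P3 : ideal_pair p 3 3 by rewrite -[X in _ X]mulr1; apply: mem_ideal_pair_r.
have cube_sub := ideal_pair_cube_sub Op O3 Ov p_cube.
exists (ideal_pair p 3); split.
  apply: (prime_ideal_of_residue (l := 3)) => //; first exact: ideal_pair_is_ideal.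
  move=> P1; have [x Ox] : principal_ideal 3 (1 * 1 * 1).
    by apply: cube_sub; do 2?[apply: mem_ideal_mul].
  by rewrite !mulr1; apply: natr_not_unit.
apply/seteqP; split=> // _ [y Oy <-].
have /dvdzP[k k_eq] := Fermat_dvdz (isT : prime 3) c_ndvd.
pose e : K := 1 - 3 * k%:~R + 9 * k%:~R ^+ 2.
have Oe : O e by rewrite /e; integral.
have c_sqr : c%:~R ^+ 2 = 1 + 3 * k%:~R :> K.
  by rewrite -rmorphXn -(subrK 1 (c ^+ 2)) k_eq rmorphD rmorphM /=; ring.
(* 3 c^2 lies in the cube of the ideal, and c^2 is a unit modulo 27. *)
have -> : 3 * y = p * p * (p * ((c%:~R - p * w) * e * y))
    + p * p * (3 * (w ^+ 2 * e * y)) + 3 * 3 * (3 * (- 3 * k%:~R ^+ 3 * y)).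
  transitivity (3 * c%:~R ^+ 2 * e * y - 81 * k%:~R ^+ 3 * y).
    by rewrite c_sqr /e; ring.
  transitivity (p ^+ 3 * (c%:~R - p * w) * e * y + 3 * p ^+ 2 * w ^+ 2 * e * y
    - 81 * k%:~R ^+ 3 * y); first by rewrite p_cube; ring.
  by ring.
have PPp : ideal_mul (ideal_pair p 3) (ideal_pair p 3) (p * p) by apply: mem_ideal_mul.
have PP3 : ideal_mul (ideal_pair p 3) (ideal_pair p 3) (3 * 3) by apply: mem_ideal_mul.
apply: ideal_mulD; [apply: ideal_mulD |]; apply: mem_ideal_mul => //.
- by apply: mem_ideal_pair_l; integral.
- by apply: mem_ideal_pair_r; integral.
- by apply: mem_ideal_pair_r; integral.
Qed.

(* When 3 O = P^3 the ring O / 3 O is local with nilpotent maximal ideal, so that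
   an idempotent modulo nilpotents is trivial. *)
Lemma wildly_ramified_idempotent x : wildly_ramified_at_3 K -> O x ->
  principal_ideal 3 (x ^+ 2 * (x - 1)) ->
  principal_ideal 3 (x ^+ 2) \/ principal_ideal 3 (x - 1).
Proof.
move=> [P [[[PO P0 PD PM] P1 prime_P] eP]] Ox x_idem.
have O1 : O 1 := ring_of_integers_nat K 1.
have Ox1 : O (x - 1) by integral.
have cube_P y : P y -> principal_ideal 3 (y ^+ 3).
  by move=> Py; rewrite /principal_ideal eP exprSr expr2; do 2?[apply: mem_ideal_mul].
have sub_P : principal_ideal 3 `<=` P.
  rewrite /principal_ideal eP; apply: ideal_mul_sub => // y z PPy Pz.
  apply: PM => //; move: y PPy; apply: ideal_mul_sub.
  - exact: (ring_of_integers_nat K 0).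
  - exact: ring_of_integersD.
  - by move=> y y' /PO Oy /PO Oy'; apply: ring_of_integersM.
have : P x \/ P (x - 1).
  have : P (x * (x * (x - 1))) by apply: sub_P; rewrite mulrA -expr2.
  by case/(prime_P _ _ Ox (ring_of_integersM Ox Ox1)) => [|/(prime_P _ _ Ox Ox1)[]];
    [left | left | right].
case=> /cube_P x_cube; [left | right].
  have -> : x ^+ 2 = x ^+ 3 + (- 1) * (x ^+ 2 * (x - 1)) by ring.
  by apply: principal_idealD => //; apply: principal_idealMl => //; integral.
have -> : x - 1 = (3 - 2 * x) * (x ^+ 2 * (x - 1)) + (1 + 2 * x) * (x - 1) ^+ 3 by ring.
by apply: principal_idealD; apply: principal_idealMl => //; integral.
Qed.

End Ideals.

Section PureRamification.
Variables (K : fieldExtType rat) (a b : nat) (al be : K).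
Hypothesis pure_ab : pure_pair a b al be.
Local Notation m := (pure_radicand a b).
Local Notation O := (@ring_of_integers K).

Lemma tame_elt_cubic (j : int) : m ^+ 2 - 1 = j * 9 ->
  let e := tame_elt a b al be in e ^+ 2 * (e - 1) = 3 * (j%:~R * e + j%:~R ^+ 2).
Proof.
move=> m2_eq e.
have j_eq : j%:~R = ((a%:R * b%:R ^+ 2) ^+ 2 - 1) / 9 :> rat.
  by rewrite -pure_radicandE -rmorphXn -[1]/(1%:~R) -rmorphB m2_eq rmorphM mulfK.
have := pure_char_poly pure_ab (1%:~R / 3) (m%:~R / 3) (b%:~R / 3).
have -> : 3 * (1%:~R / 3) = 1 :> rat by field.
have -> : 3 * pure_minor a%:R b%:R (1%:~R / 3) (m%:~R / 3) (b%:~R / 3) =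
  - 3 * j%:~R :> rat.
  by rewrite /pure_minor pure_radicandE j_eq -pmulrn; field.
have -> : pure_norm a%:R b%:R (1%:~R / 3) (m%:~R / 3) (b%:~R / 3) = 3 * j%:~R ^+ 2 :> rat.
  by rewrite /pure_norm pure_radicandE j_eq -pmulrn; field.
rewrite -/(third_comb al be 1 m b) -/(tame_elt a b al be) -/e.
rewrite /= -(rmorph_int (in_alg K) j) => e_root.
apply/eqP; rewrite -subr_eq0 -[X in _ == X]e_root; apply/eqP.
by rewrite -!/(in_alg K _); ring.
Qed.

Lemma principal_ideal3_coord0 (x0 x1 x2 : rat) :
  principal_ideal 3 (rat_comb al be x0 x1 x2) -> x0 \is a Num.int.
Proof.
move=> [t Ot t_eq].
have t_comb : t = rat_comb al be (x0 / 3) (x1 / 3) (x2 / 3).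
  have three_neq0 : (3 : K) != 0 by rewrite -(rmorph_nat (in_alg K)) fmorph_eq0.
  apply: (mulfI three_neq0); rewrite t_eq -[3](rmorph_nat (in_alg K)) rat_combZ.
  by congr rat_comb; field.
rewrite t_comb in Ot; have [+ _ _] := (pure_integralP pure_ab _ _ _).1 Ot.
by rewrite mulrC divfK.
Qed.

Lemma tame_not_wildly_ramified : tame_radicand a b -> ~ wildly_ramified_at_3 K.
Proof.
move=> tame_ab wild; have Oe := (tame_elt_integralP pure_ab).2 tame_ab.
have /dvdzP[j m2_eq] := tame_ab; have e_cubic := tame_elt_cubic m2_eq.
have e_idem : principal_ideal 3 (tame_elt a b al be ^+ 2 * (tame_elt a b al be - 1)).
  by rewrite e_cubic; exists (j%:~R * tame_elt a b al be + j%:~R ^+ 2) => //; integral.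
have [] := wildly_ramified_idempotent wild Oe e_idem.
  rewrite expr2 (rat_combM pure_ab) => /principal_ideal3_coord0.
  have -> : 1%:~R / 3 * (1%:~R / 3) + a%:R * b%:R *
      (m%:~R / 3 * (b%:~R / 3) + b%:~R / 3 * (m%:~R / 3)) =
        (1 + 6 * j)%:~R / 3%:~R :> rat.
    transitivity ((1 + 2 * (m ^+ 2)%:~R) / 9 : rat).
      by rewrite rmorphXn /= pure_radicandE -pmulrn; field.
    by rewrite -(subrK 1 (m ^+ 2)) m2_eq !(rmorphD, rmorphM) /=; field.
  by rewrite intr_div_is_int//; lia.
have -> : tame_elt a b al be - 1 = rat_comb al be (1%:~R / 3 - 1) (m%:~R / 3) (b%:~R / 3).
  have one_comb : 1 = rat_comb al be 1 0 0 by rewrite -rat_comb_alg rmorph1.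
  by rewrite [X in _ - X]one_comb rat_combB !subr0.
move=> /principal_ideal3_coord0.
have -> : 1%:~R / 3 - 1 = (-2)%:~R / 3%:~R :> rat by field.
by rewrite intr_div_is_int.
Qed.

Lemma pure_residue : ~~ (3 %| b)%N -> ~~ tame_radicand a b ->
  forall x, O x -> exists i : int, ideal_pair (al - m%:~R) 3 (x - i%:~R).
Proof.
move=> b_ndvd wild_ab x Ox; have [n0 [n1 [n2 ->]]] := wild_integers pure_ab wild_ab Ox.
have Oal := ring_of_integers_pure pure_ab.
have Obe := ring_of_integers_pure (pure_pairC pure_ab).
have /dvdzP[k k_eq] := Fermat_dvdz (isT : prime 3) (b_ndvd : ~~ (3 %| b%:Z)%Z).
have b_sqr : (b%:R : K) ^+ 2 = 1 + 3 * k%:~R.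
  by rewrite -[b%:R]/(b%:~R) -rmorphXn -(subrK 1 (b%:Z ^+ 2)) k_eq rmorphD rmorphM /=;
    ring.
have [alal _ _] := pure_pair_relations pure_ab.
exists (n0 + n1 * m + n2 * b%:Z * m ^+ 2).
exists (n1%:~R + n2%:~R * b%:R * (al + m%:~R)), (- k%:~R * n2%:~R * be).
split; [by integral | by integral |].
rewrite /rat_comb !rmorph_int !(rmorphD, rmorphM, rmorphXn) /= -pmulrn.
apply/eqP; rewrite -subr_eq0; apply/eqP.
transitivity (n2%:~R * (1 + 3 * k%:~R - b%:R ^+ 2) * be
  - n2%:~R * b%:R * (al * al - b%:R * be)); first by ring.
by rewrite b_sqr alal !subrr; ring.
Qed.

Lemma not_tame_ndvdz9 :
  ~~ (3 %| b)%N -> ~~ tame_radicand a b -> ~~ (9 %| m * (m ^+ 2 - 1))%Z.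
Proof.
move=> b_ndvd wild_ab.
have coprime9 (x : int) : ~~ (3 %| x)%Z -> coprimez 9 x.
  by rewrite coprimezE (@coprime_pexpl 2 3)// prime_coprime.
have [m_dvd|/coprime9 m_coprime] := boolP (3 %| m)%Z; last by rewrite Gauss_dvdzr.
have /coprime9 m2_coprime : ~~ (3 %| m ^+ 2 - 1)%Z.
  by have /dvdzP[k ->] := m_dvd; lia.
rewrite Gauss_dvdzl// /pure_radicand Gauss_dvdzl; last first.
  by rewrite coprimezE abszX coprimeXr// -coprimezE coprime9.
by apply/negP => /(pure_squarefree_l pure_ab (d := 3)).
Qed.

Lemma not_tame_wildly_ramified :
  ~~ (3 %| b)%N -> ~~ tame_radicand a b -> wildly_ramified_at_3 K.
Proof.
move=> b_ndvd wild_ab; have Oal := ring_of_integers_pure pure_ab.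
have [c c_eq] : exists c, m - m ^+ 3 = c * 3.
  apply/dvdzP; have -> : m - m ^+ 3 = - (m * (m ^+ 2 - 1)) by ring.
  rewrite rpredN (@Euclid_dvdzM 3)// orbC -implyNb; apply/implyP.
  by apply: contraNT => /(Fermat_dvdz (isT : prime 3)).
apply: (@wildly_ramified_of_uniformizer _ (al - m%:~R) (- m%:~R * al) c).
- by integral.
- by integral.
- apply: contra (not_tame_ndvdz9 b_ndvd wild_ab) => /dvdzP[d d_eq].
  by apply/dvdzP; exists (- d); rewrite d_eq in c_eq; lra.
- transitivity (al ^+ 3 - m%:~R ^+ 3 - 3 * m%:~R * al * (al - m%:~R)); first by ring.
  rewrite (pure_relations_cube (pure_pair_relations pure_ab)) -pure_radicandE.
  have -> : m%:~R - m%:~R ^+ 3 = 3 * c%:~R :> K.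
    by rewrite -rmorphXn -rmorphB c_eq rmorphM mulrC.
  by ring.
- exact: pure_residue.
Qed.

End PureRamification.

Lemma wildly_ramified_pureP (K : fieldExtType rat) (a b : nat) (al be : K) :
  pure_pair a b al be -> wildly_ramified_at_3 K <-> ~~ tame_radicand a b.
Proof.
move=> pure_ab; split=> [wild|wild_ab].
  by apply/negP => /(tame_not_wildly_ramified pure_ab)/(_ wild).
have [b_dvd|b_ndvd] := boolP (3 %| b)%N; last first.
  exact: not_tame_wildly_ramified pure_ab b_ndvd wild_ab.
have pure_ba := pure_pairC pure_ab.
apply: (not_tame_wildly_ramified pure_ba (pure_pair_dvd3 pure_ba b_dvd)).
by apply/negP => /tame_factors_ndvd3[]; rewrite b_dvd.
Qed.

(** * The trace *)

Section FieldTrace.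
Variable K : fieldExtType rat.
Implicit Types x : K.

Fact field_trace_is_linear : scalar (@field_trace K).
Proof.
move=> c x y; rewrite /field_trace linearP passmx.mxof_linear.
by rewrite mxtraceD mxtraceZ.
Qed.

HB.instance Definition _ :=
  GRing.isLinear.Build rat K rat *%R (@field_trace K) field_trace_is_linear.

Lemma field_trace_alg (q : rat) : field_trace (q%:A : K) = (\dim {:K})%:R * q.
Proof.
rewrite linearZ /= /field_trace.
have -> : amull (1 : K) = \1%VF by apply/lfunP => x; rewrite !lfunE /= mul1r.
by rewrite passmx.mxof1 ?mxtrace1 1?mulrC// (basis_free (vbasisP _)).
Qed.

Fact perp_is_linear : linear (@perp K).
Proof.
move=> c x y; rewrite /perp linearP scalerDl -scalerA mulrDr -scalerAr scalerBr.
by rewrite opprD addrACA.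
Qed.

HB.instance Definition _ := GRing.isLinear.Build rat K K *:%R (@perp K) perp_is_linear.

Lemma perp_alg (q : rat) : \dim {:K} = 3%N -> perp (q%:A : K) = 0.
Proof.
move=> dimK; rewrite /perp field_trace_alg dimK -scalerA scaler_nat.
by rewrite mulr_natl subrr.
Qed.

Lemma field_trace_perp x : \dim {:K} = 3%N -> field_trace (perp x) = 0.
Proof.
move=> dimK; rewrite /perp linearB /= field_trace_alg dimK mulr_natl raddfMn /=.
by rewrite mulr_natl subrr.
Qed.

End FieldTrace.

Lemma rmorph_independent (K F : fieldType) (n : nat)
    (sigma : 'I_n -> {rmorphism K -> F}) (c : 'I_n -> F) :
  injective (fun i => sigma i : K -> F) ->
  (forall x, \sum_i c i * sigma i x = 0) -> forall i, c i = 0.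
Proof.
elim: n sigma c => [|n IHn] sigma c sigma_inj sum0; first by case.
have tail0 i : c (lift ord0 i) = 0.
  have [y sigma_y] : exists y, sigma (lift ord0 i) y != sigma ord0 y.
    apply: contrapT => eq_sigma;
      have /sigma_inj : sigma (lift ord0 i) = sigma ord0 :> (K -> F).
      by apply/funext => y; apply/eqP/negPn/negP => neq; apply: eq_sigma; exists y.
    by move/eqP; rewrite eq_sym (negPf (neq_lift _ _)).
  pose d j := c (lift ord0 j) * (sigma (lift ord0 j) y - sigma ord0 y).
  suff /(IHn (fun j => sigma (lift ord0 j)) d) :
    forall x, \sum_j d j * sigma (lift ord0 j) x = 0.
    move=> /(_ _ i) d0; apply/eqP;
      have /eqP := d0 (fun j k e => lift_inj (sigma_inj _ _ e)).
    by rewrite mulf_eq0 subr_eq0 (negPf sigma_y) orbF.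
  move=> x.
  transitivity (\sum_j c j * sigma j (x * y) - sigma ord0 y * \sum_j c j * sigma j x).
    rewrite mulr_sumr -sumrB big_ord_recl [X in X + _](_ : _ = 0); last first.
      by rewrite rmorphM; ring.
    rewrite add0r; apply: eq_bigr => j _.
    by rewrite /d rmorphM; ring.
  by rewrite !sum0 mulr0 subr0.
move=> i; have [j ->|->] := unliftP ord0 i; first exact: tail0.
have := sum0 1; rewrite big_ord_recl rmorph1 mulr1 big1 ?addr0// => j _.
by rewrite tail0 mul0r.
Qed.

Lemma rmorphZ_rat (K : fieldExtType rat) (F : numFieldType)
    (phi : {rmorphism K -> F}) (q : rat) (x : K) : phi (q *: x) = ratr q * phi x.
Proof. by rewrite -mulr_algl rmorphM -[q%:A]/(in_alg K q) rmorph_in_alg. Qed.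

(* The embeddings diagonalize the matrix of multiplication by x. *)
Lemma field_trace_sum (K : fieldExtType rat) (F : numFieldType) (n : nat)
    (sigma : 'I_n -> {rmorphism K -> F}) (x : K) :
  \dim {:K} = n -> injective (fun i => sigma i : K -> F) ->
  ratr (field_trace x) = \sum_i sigma i x.
Proof.
move=> dimK; case: n / dimK sigma => sigma sigma_inj; pose e := vbasis {:K}.
have e_basis : basis_of {:K} e := vbasisP _.
pose A := map_mx (ratr : rat -> F) (passmx.mxof e e (amull x)).
pose S := \matrix_(j, i < \dim {:K}) sigma i e`_j.
pose D := diag_mx (\row_i sigma i x).
have AS : A *m S = S *m D.
  apply/matrixP => j i; rewrite mul_mx_diag !mxE mulrC -rmorphM /=.
  rewrite [x * _](coord_basis e_basis (memvf _)) rmorph_sum; apply: eq_bigr => k _.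
  by rewrite !mxE /= passmx.vecof_delta lfunE /= rmorphZ_rat.
have S_unit : S \in unitmx.
  rewrite -unitmx_tr -row_free_unit -kermx_eq0; apply/rowV0P => u /sub_kermxP uS.
  apply/rowP => i; rewrite mxE.
  apply: (rmorph_independent (c := fun i => u 0 i) sigma_inj) => y.
  rewrite (coord_basis e_basis (memvf y)).
  transitivity (\sum_k ratr (coord e k y) * (u *m S^T) 0 k); last first.
    by rewrite uS big1// => k _; rewrite mxE mulr0.
  under eq_bigr do rewrite rmorph_sum mulr_sumr; rewrite exchange_big.
  apply: eq_bigr => k _; rewrite mxE mulr_sumr; apply: eq_bigr => j _.
  by rewrite !mxE rmorphZ_rat mulrCA.
have -> : ratr (field_trace x) = \tr A by rewrite /field_trace trace_map_mx.
rewrite -[A](mulmxK S_unit) AS mxtrace_mulC mulKmx// mxtrace_diag.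
by apply: eq_bigr => i _; rewrite mxE.
Qed.

Lemma sum_ord3 (V : nmodType) (f : 'I_3 -> V) : \sum_i f i = f 0 + f 1 + f 2.
Proof.
by rewrite !big_ord_recr big_ord0 /= add0r; congr (f _ + f _ + f _); apply/val_inj.
Qed.

(** * Embeddings of a complex cubic field *)

Lemma sqr_normc (R : realType) (z : R[i]) :
  Normc.normc z ^+ 2 = complex.Re z ^+ 2 + complex.Im z ^+ 2.
Proof. by case: z => u v; rewrite /= sqr_sqrtr// addr_ge0 ?sqr_ge0. Qed.

Lemma Im_conjc (R : realType) (z : R[i]) : complex.Im (conjc z) = - complex.Im z.
Proof. by case: z. Qed.

Section CubicEmbeddings.
Variables (R : realType) (K : fieldExtType rat).
Variables (rho : {rmorphism K -> R}) (g : {rmorphism K -> R[i]}).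

Definition cubic_embedding (i : 'I_3) : {rmorphism K -> R[i]} :=
  nth g [:: (real_complex R \o rho : {rmorphism K -> R[i]}); g;
            (conjc \o g : {rmorphism K -> R[i]})] i.

Definition cubic_embeddings : Prop :=
  (exists x, complex.Im (g x) != 0) /\
  @embeddings R K = range (fun i => cubic_embedding i : K -> R[i]).

Lemma cubic_embedding_inj :
  (exists x, complex.Im (g x) != 0) -> injective (fun i => cubic_embedding i : K -> R[i]).
Proof.
move=> [x g_nonreal] i j /(congr1 (fun f => complex.Im (f x))).
pose v := complex.Im (g x).
have ImE k : complex.Im (cubic_embedding k x) = nth 0 [:: 0; v; - v] k.
  by case: k => -[|[|[|//]]] lt_k3; rewrite /cubic_embedding /= ?Im_conjc.
rewrite !ImE => /eqP; rewrite nth_uniq ?ltn_ord//= => [/eqP/val_inj //|].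
by rewrite !inE negb_or -eqr_oppLR oppr0 eq_sym g_nonreal eq_sym eqNr g_nonreal.
Qed.

Hypotheses (dimK : \dim {:K} = 3%N) (emb : cubic_embeddings).

Lemma cubic_trace (x : K) : ratr (field_trace x) = rho x + 2 * complex.Re (g x).
Proof.
have := field_trace_sum x dimK (cubic_embedding_inj emb.1).
rewrite sum_ord3 /cubic_embedding /= -(fmorph_eq_rat (real_complex R \o ratr)).
move=> /(congr1 (@complex.Re R)) /= ->.
by case: (g x) => u v /=; ring.
Qed.

Definition minkowski_norm (x : K) : R := 3 * rho x ^+ 2 - ratr (field_trace (x ^+ 2)).

Lemma sum_sqr_embeddings (x : K) : field_trace x = 0 ->
  \sum_(k \in @embeddings R K) Normc.normc (k x) ^+ 2 = minkowski_norm x.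
Proof.
move=> tr0; rewrite emb.2 fsbig_image; last first.
  exact: in2W (cubic_embedding_inj emb.1).
rewrite (_ : setT = [set` index_enum 'I_3]); last first.
  by apply/seteqP; split=> // i _ /=; rewrite mem_index_enum.
rewrite -fsbig_seq ?index_enum_uniq// sum_ord3 /cubic_embedding /= expr0n addr0.
rewrite !sqr_normc /minkowski_norm cubic_trace !rmorphXn /=.
have := cubic_trace x; rewrite tr0 rmorph0 sqr_sqrtr ?sqr_ge0//.
case: (g x) => u v /= tr_eq; have -> : u = - rho x / 2 by lra.
by field.
Qed.

Lemma minkowski_formE (a1 a2 : K) (x y : int) :
  @minkowski_form R K a1 a2 x y = minkowski_norm (perp (a1 *~ x + a2 *~ y)).
Proof.
rewrite /minkowski_form -!raddfMz -raddfD.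
by apply: sum_sqr_embeddings; apply: field_trace_perp.
Qed.

Lemma embedding_rational (x : K) (q : rat) : rho x = ratr q -> x = q%:A.
Proof.
by move=> rho_x; apply: (fmorph_inj rho); rewrite rho_x rmorphZ_rat rmorph1 mulr1.
Qed.

(* The polar form of [minkowski_norm] at (x, y) is 6 rho(x y) - 2 Tr(x y). *)
Lemma rational_mul_of_minkowski_norm (x y : K) :
  minkowski_norm (x + y) = minkowski_norm (x - y) -> exists q : rat, x * y = q%:A.
Proof.
rewrite /minkowski_norm rmorphD rmorphB /=.
have -> : field_trace ((x + y) ^+ 2) =
  field_trace ((x - y) ^+ 2) + 4 * field_trace (x * y).
  have -> : (x + y) ^+ 2 = (x - y) ^+ 2 + 4%:R *: (x * y) by rewrite scaler_nat; ring.
  by rewrite linearD linearZ.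
rewrite rmorphD rmorphM rmorph_nat /= => norm_eq.
exists (field_trace (x * y) / 3); apply: embedding_rational.
by rewrite rmorphM fmorph_div rmorph_nat /=; lra.
Qed.

End CubicEmbeddings.

Section RealEmbedding.
Variables (R : realType) (K : fieldExtType rat).

Lemma real_embedding (f : {rmorphism K -> R[i]}) : real_valued (f : K -> R[i]) ->
  exists rho : {rmorphism K -> R}, f = real_complex R \o rho :> (K -> R[i]).
Proof.
move=> f_real; pose rho x := complex.Re (f x).
have fE x : f x = real_complex R (rho x).
  by have := f_real x; rewrite /rho; case: (f x) => u v /= ->.
have rhoB : zmod_morphism rho.
  by move=> x y; apply: (@complexI R); rewrite rmorphB /= -!fE rmorphB.
have rhoM : monoid_morphism rho.
  split=> [|x y]; apply: (@complexI R); first by rewrite -fE !rmorph1.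
  by rewrite rmorphM /= -!fE rmorphM.
pose phi : {rmorphism K -> R} := HB.pack rho
  (GRing.isZmodMorphism.Build K R rho rhoB) (GRing.isMonoidMorphism.Build K R rho rhoM).
by exists phi; apply/funext => x; rewrite fE.
Qed.

Lemma complex_cubic_embeddings : is_complex_cubic R K ->
  exists (rho : {rmorphism K -> R}) (g : {rmorphism K -> R[i]}), cubic_embeddings rho g.
Proof.
move=> [_ /eq_cardSP[f0 [[f f_eq] f_real]]]; rewrite II0 card_eq0 => /eqP no_real.
move=> /eq_cardSP[g0 [[g g_eq] g_nonreal]] /eq_cardSP[h0 [[[h h_eq] h_nonreal] h_neq_g]].
rewrite II0 card_eq0 => /eqP no_nonreal; subst f0 g0 h0.
have [rho f_eq] := real_embedding f_real.
have embP k : @embeddings R K k -> [\/ k = f, k = g | k = h].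
  move=> k_emb; have [k_real|k_nonreal] := pselect (real_valued k).
    constructor 1; apply: contrapT => k_neq_f.
    by have : (set0 : set (K -> R[i])) k by rewrite -no_real.
  have [->|k_neq_g] := pselect (k = g); first by constructor 2.
  constructor 3; apply: contrapT => k_neq_h.
  by have : (set0 : set (K -> R[i])) k by rewrite -no_nonreal.
have [x gx_nonreal] : exists x, complex.Im (g x) != 0.
  apply: contrapT => all_real; apply: g_nonreal => x /=; apply/eqP/negPn/negP => gx.
  by apply: all_real; exists x.
have h_conj : (h : K -> R[i]) = conjc \o g.
  have [|e|e|//] := embP (conjc \o g);
    first by exists (conjc \o g : {rmorphism K -> R[i]}).
    have := congr1 (fun k => complex.Im (k x)) e; rewrite f_eq /= Im_conjc => /eqP.
    by rewrite oppr_eq0 (negPf gx_nonreal).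
  have := congr1 (fun k => complex.Im (k x)) e; rewrite /= Im_conjc => /eqP.
  by rewrite eqNr (negPf gx_nonreal).
exists rho, g; split; first by exists x.
apply/seteqP; split=> [k /embP[] ->|_ [i _ <-]]; last by exists (cubic_embedding rho g i).
- by exists 0; rewrite ?f_eq.
- by exists 1.
- by exists 2; rewrite ?h_conj.
Qed.

Lemma is_complex_cubic_of_embeddings (rho : {rmorphism K -> R})
    (g : {rmorphism K -> R[i]}) :
  \dim {:K} = 3%N -> cubic_embeddings rho g -> is_complex_cubic R K.
Proof.
move=> dimK [[x g_nonreal] embE]; pose h : {rmorphism K -> R[i]} := conjc \o g.
have emb_inj := @cubic_embedding_inj R K rho g (ex_intro _ x g_nonreal).
have embP k : @embeddings R K k <-> [\/ k = real_complex R \o rho, k = g | k = h].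
  rewrite embE; split=> [[[[|[|[|//]]] lt_i3] _ <-]|[] ->].
  - by constructor 1.
  - by constructor 2.
  - by constructor 3.
  - by exists 0.
  - by exists 1.
  - by exists 2.
have gx : ~ real_valued (g : K -> R[i]) by move=> /(_ x) /eqP; rewrite (negPf g_nonreal).
have hx : ~ real_valued (h : K -> R[i]).
  by move=> /(_ x) /eqP; rewrite /h /= Im_conjc oppr_eq0 (negPf g_nonreal).
split=> //.
  rewrite (_ : _ `&` _ = [set (real_complex R \o rho : K -> R[i])]);
    first exact: card_set1.
  apply/seteqP; split=> [k [/embP[] -> //]|_ ->].
  by split; [apply/embP; constructor 1 | ].
apply/eq_cardSP; exists (g : K -> R[i]); first by split=> //; apply/embP; constructor 2.
rewrite (_ : _ `\` _ = [set (h : K -> R[i])]); first exact: card_set1.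
apply/seteqP; split=> [k [[/embP[] ->] k_nonreal k_neq_g]|_ ->] //.
- by case: k_nonreal.
- by case: k_neq_g.
split; first by split=> //; apply/embP; constructor 3.
by move=> h_eq_g; have := emb_inj 2 1 h_eq_g.
Qed.

End RealEmbedding.

(** * The Gauss domain *)

Section GaussDomain.
Variable R : realType.
Implicit Types (x y : R) (z : R[i] : numFieldType).

Lemma nbhs_complexP x y (A : set (R[i] : numFieldType)) :
  nbhs (Complex x y : (R[i] : numFieldType)) A <->
  exists2 e : R, 0 < e &
    forall p q : R, `|p| < e -> `|q| < e -> A (Complex (x + p) (y + q)).
Proof.
have distE (p q : R) : `|(Complex x y - Complex (x + p) (y + q) : R[i])| =
    real_complex R (Num.sqrt (p ^+ 2 + q ^+ 2)).
  by rewrite normc_def /=; congr (real_complex R (Num.sqrt _)); ring.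
split=> [/nbhs_ballP[[e e'] /=]|[e e_gt0 sub_A]].
  rewrite ltcE /= => /andP[/eqP-> e_gt0] sub_A; exists (e / 2); first by rewrite divr_gt0.
  move=> p q p_lt q_lt; apply: sub_A; rewrite /ball /= distE ltcR.
  rewrite -(ger0_norm (ltW e_gt0)) -sqrtr_sqr ltr_sqrt ?exprn_gt0//.
  rewrite -(real_normK (num_real p)) -(real_normK (num_real q)).
  by have := normr_ge0 p; have := normr_ge0 q; nra.
apply/nbhs_ballP; exists (real_complex R e); first by rewrite /= ltcR.
have norm_lt (p q : R) : Num.sqrt (p ^+ 2 + q ^+ 2) < e -> `|p| < e.
  apply: le_lt_trans; rewrite -sqrtr_sqr ler_sqrt ?addr_ge0 ?sqr_ge0//.
  by rewrite lerDl sqr_ge0.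
case=> u v; rewrite -(subrK x u) -(subrK y v) ![_ + x]addrC ![_ + y]addrC.
rewrite /ball /= distE ltcR => dist_lt; apply: sub_A; first exact: norm_lt dist_lt.
by rewrite addrC in dist_lt; apply: norm_lt dist_lt.
Qed.

Definition gauss_edge z : Prop :=
  [\/ complex.Re z = 0, complex.Re z = 2^-1 |
      complex.Re z ^+ 2 + complex.Im z ^+ 2 = 1].

Definition gauss_interior z : Prop :=
  [/\ 0 < complex.Re z, complex.Re z < 2^-1 &
      1 < complex.Re z ^+ 2 + complex.Im z ^+ 2].

Lemma gauss_domain_edgeVinterior z :
  gauss_domain z -> gauss_edge z \/ gauss_interior z.
Proof.
move=> [_ /andP[x_ge0 x_le] norm_ge1].
have [x0|x_neq0] := eqVneq (complex.Re z) 0; first by left; constructor 1.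
have [x_half|x_neq] := eqVneq (complex.Re z) 2^-1; first by left; constructor 2.
have [norm1|norm_neq1] := eqVneq (complex.Re z ^+ 2 + complex.Im z ^+ 2) 1.
  by left; constructor 3.
by right; split;
  rewrite lt_neqAle ?x_ge0 ?x_le ?x_neq ?norm_ge1 1?eq_sym ?x_neq0 ?norm_neq1.
Qed.

Lemma gauss_interior_sub z :
  gauss_domain z -> gauss_interior z -> interior (@gauss_domain R) z.
Proof.
case: z => x y [/= y_gt0 _ _] [/= x_gt0 x_lt norm_gt1]; apply/nbhs_complexP.
pose d := (x ^+ 2 + y ^+ 2 - 1) / (2 * (x + y)).
have xy_gt0 : 0 < 2 * (x + y) by lra.
have d_gt0 : 0 < d by rewrite divr_gt0// subr_gt0.
have d_eq : d * (2 * (x + y)) = x ^+ 2 + y ^+ 2 - 1 by rewrite divfK// gt_eqF.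
pose e := Num.min (Num.min x (2^-1 - x)) (Num.min y d).
have [e_le_x e_le_half e_le_y e_le_d] : [/\ e <= x, e <= 2^-1 - x, e <= y & e <= d].
  by rewrite /e !ge_min !lexx !orbT.
have e_gt0 : 0 < e by rewrite /e !lt_min x_gt0 y_gt0 d_gt0 subr_gt0 x_lt.
exists e => // p q; rewrite !ltr_norml => /andP[p_gt p_lt] /andP[q_gt q_lt].
split; rewrite /=; first by lra.
  by apply/andP; split; lra.
have : (x - e) ^+ 2 <= (x + p) ^+ 2 by rewrite ler_sqr ?nnegrE; lra.
have : (y - e) ^+ 2 <= (y + q) ^+ 2 by rewrite ler_sqr ?nnegrE; lra.
have : e * (2 * (x + y)) <= d * (2 * (x + y)) by rewrite ler_pM2r.
by nra.
Qed.

Lemma gauss_domain_boundaryP z : gauss_domain z ->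
  boundary (@gauss_domain R) z <-> gauss_edge z.
Proof.
move=> gauss_z; split=> [[_ not_interior]|edge].
  by have [//|/(gauss_interior_sub gauss_z)] := gauss_domain_edgeVinterior gauss_z.
split; first exact: subset_closure.
have [y_gt0 _ _] := gauss_z.
case: z {gauss_z} y_gt0 edge => x y /= y_gt0 edge.
move=> /nbhs_complexP[e e_gt0 sub_gauss].
have e2_lt : `|e / 2| < e by rewrite ger0_norm; lra.
have zero_lt : `|0 : R| < e by rewrite normr0.
case: edge => [/= x_eq|/= x_eq|/= norm_eq].
- have e2N_lt : `|- (e / 2)| < e by rewrite normrN.
  by have [_ /= /andP[+ _] _] := sub_gauss _ _ e2N_lt zero_lt; lra.
- by have [_ /= /andP[_ +] _] := sub_gauss _ _ e2_lt zero_lt; lra.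
- pose d := Num.min e y / 2.
  have min_gt0 : 0 < Num.min e y by rewrite lt_min e_gt0.
  have [min_e min_y] : Num.min e y <= e /\ Num.min e y <= y by rewrite !ge_min !lexx orbT.
  have dN_lt : `|- d| < e by rewrite normrN ger0_norm /d; lra.
  by have [_ _ /=] := sub_gauss _ _ zero_lt dN_lt; rewrite addr0 /d; nra.
Qed.

Lemma zero_notin_gauss_boundary : ~ boundary (@gauss_domain R) 0.
Proof.
move=> [/(_ [set w : R[i] | `|complex.Re w| < 2^-1 /\ `|complex.Im w| < 2^-1]) + _].
case; first by apply/nbhs_complexP; exists 2^-1; rewrite ?invr_gt0// => p q;
  rewrite /= !add0r.
move=> w [[_ _ norm_ge1] [/= re_lt im_lt]].
by rewrite !ltr_norml in re_lt im_lt; have /andP[? ?] := re_lt;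
  have /andP[? ?] := im_lt; nra.
Qed.

End GaussDomain.

(** * Binary forms and the action of GL2(Z) *)

Lemma det_mx22 (A : comPzRingType) (g : 'M[A]_2) :
  \det g = g 0 0 * g 1 1 - g 0 1 * g 1 0.
Proof.
rewrite (expand_det_row _ 0) !big_ord_recl big_ord0 addr0 /cofactor !det_mx11 !mxE /=.
have -> : lift 0 0 = 1 :> 'I_2 by apply/val_inj.
have -> : lift 1 0 = 0 :> 'I_2 by apply/val_inj.
by ring.
Qed.

Section BinaryForms.
Variable R : realType.
Implicit Types (z w : R[i]) (g : 'M[int]_2).

Lemma sqr_normc_lincomb z (x y : int) :
  Normc.normc (x%:~R + y%:~R * z) ^+ 2 =
  (x%:~R + y%:~R * complex.Re z) ^+ 2 + (y%:~R * complex.Im z) ^+ 2.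
Proof.
rewrite -!(rmorph_int (real_complex R)) sqr_normc; case: z => u v /=.
by ring.
Qed.

Lemma Im_div z w : complex.Im (z / w) =
  (complex.Im z * complex.Re w - complex.Re z * complex.Im w) / Normc.normc w ^+ 2.
Proof. by rewrite sqr_normc; case: z w => [u v] [u' v'] /=; ring. Qed.

Lemma unit_det_sqr g : g \in unitmx -> \det g ^+ 2 = 1.
Proof. by rewrite unitmxE => /orP[]/eqP->. Qed.

Definition GL2Z_arg g z : R[i] := if \det g == 1 then z else conjc z.

Definition GL2Z_den g z : R[i] := (g 1 0)%:~R * GL2Z_arg g z + (g 1 1)%:~R.

Lemma GL2Z_argE g z : g \in unitmx ->
  complex.Re (GL2Z_arg g z) = complex.Re z /\
  complex.Im (GL2Z_arg g z) = (\det g)%:~R * complex.Im z.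
Proof.
rewrite unitmxE /GL2Z_arg => /orP[]/eqP->; case: z => u v /=.
  by rewrite mul1r.
by rewrite mulN1r.
Qed.

Lemma Im_GL2Z_act g z : g \in unitmx ->
  complex.Im (GL2Z_act g z) = complex.Im z / Normc.normc (GL2Z_den g z) ^+ 2.
Proof.
move=> g_unit; have [re_arg im_arg] := GL2Z_argE z g_unit.
rewrite /GL2Z_act -/(GL2Z_arg g z) -/(GL2Z_den g z) Im_div; congr (_ / _).
have det_sqr : (\det g)%:~R ^+ 2 = 1 :> R.
  by rewrite -rmorphXn unit_det_sqr.
rewrite /GL2Z_den -!(rmorph_int (real_complex R)).
move: re_arg im_arg; case: (GL2Z_arg g z) => u v /= -> ->.
transitivity ((\det g)%:~R ^+ 2 * complex.Im z); last by rewrite det_sqr mul1r.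
by rewrite det_mx22 rmorphB !rmorphM /=; ring.
Qed.

Lemma normc_GL2Z_act g z (x y : int) : g \in unitmx -> GL2Z_den g z != 0 ->
  Normc.normc (x%:~R + y%:~R * GL2Z_act g z) ^+ 2 * Normc.normc (GL2Z_den g z) ^+ 2 =
  Normc.normc ((g 1 1 * x + g 0 1 * y)%:~R + (g 1 0 * x + g 0 0 * y)%:~R * z) ^+ 2.
Proof.
move=> g_unit den_neq0; have [re_arg im_arg] := GL2Z_argE z g_unit.
rewrite -exprMn -Normc.normcM mulrDl -mulrA /GL2Z_act -/(GL2Z_arg g z) -/(GL2Z_den g z).
rewrite divfK// sqr_normc_lincomb.
rewrite (_ : _ + _ =
    (g 1 1 * x + g 0 1 * y)%:~R + (g 1 0 * x + g 0 0 * y)%:~R * GL2Z_arg g z).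
  rewrite sqr_normc_lincomb re_arg im_arg; congr (_ + _).
  by rewrite mulrCA exprMn -rmorphXn unit_det_sqr// mul1r.
by rewrite /GL2Z_den !(rmorphD, rmorphM) /=; ring.
Qed.

Lemma form_root_normc (r s t : R) : 0 < complex.Im (form_root r s t) ->
  0 < r /\ forall x y : int,
    r * x%:~R ^+ 2 + s * x%:~R * y%:~R + t * y%:~R ^+ 2 =
    r * Normc.normc (x%:~R + y%:~R * form_root r s t) ^+ 2.
Proof.
rewrite /form_root /= => root_gt0.
have disc_gt0 : 0 < 4 * r * t - s ^+ 2.
  by rewrite ltNge; apply: contraTN root_gt0 => disc_le0; rewrite ler0_sqrtr// mul0r ltxx.
have r_gt0 : 0 < r.
  by move: root_gt0; rewrite pmulr_rgt0 ?sqrtr_gt0// invr_gt0 pmulr_rgt0.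
have r_neq0 : r != 0 by rewrite gt_eqF.
split=> // x y; rewrite sqr_normc_lincomb /= exprMn expr_div_n sqr_sqrtr ?ltW//.
by field.
Qed.

Lemma GL2Z_act_form g (r s t : R) z :
  g \in unitmx -> z = GL2Z_act g (form_root r s t) -> 0 < complex.Im z ->
  exists2 r' : R, 0 < r' & forall x y : int,
    r * (g 1 1 * x + g 0 1 * y)%:~R ^+ 2
      + s * (g 1 1 * x + g 0 1 * y)%:~R * (g 1 0 * x + g 0 0 * y)%:~R
      + t * (g 1 0 * x + g 0 0 * y)%:~R ^+ 2 =
    r' * Normc.normc (x%:~R + y%:~R * z) ^+ 2.
Proof.
move=> g_unit ->; rewrite Im_GL2Z_act// => im_gt0.
have den_neq0 : GL2Z_den g (form_root r s t) != 0.
  by apply: contraTneq im_gt0 => ->; rewrite Normc.normc0 expr0n invr0 mulr0 ltxx.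
have den_gt0 : 0 < Normc.normc (GL2Z_den g (form_root r s t)) ^+ 2.
  by rewrite lt0r sqr_ge0 sqrf_eq0 andbT; apply: contraNneq den_neq0 => /Normc.eq0_normc->.
have root_gt0 : 0 < complex.Im (form_root r s t).
  by move: im_gt0; rewrite pmulr_lgt0 ?invr_gt0.
have [r_gt0 formE] := form_root_normc root_gt0.
exists (r * Normc.normc (GL2Z_den g (form_root r s t)) ^+ 2); first exact: mulr_gt0.
by move=> x y; rewrite formE -normc_GL2Z_act// [X in r * X]mulrC mulrA.
Qed.

End BinaryForms.

(** * Integral bases *)

Lemma int_unit_sqr (x y : int) : x * y = 1 -> x ^+ 2 = 1.
Proof.
move=> /(congr1 absz); rewrite abszM => /eqP; rewrite muln_eq1 => /andP[/eqP x1 _].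
by have [->|->] : x = 1 \/ x = -1 by lia.
Qed.

Section IntegralBasis.
Variable K : fieldExtType rat.

Lemma int_comb_comp (a1 a2 : K) (n1 n2 p q r s c0 c1 c2 : int) :
  c0%:~R + (n1%:~R + a1 *~ p + a2 *~ q) *~ c1 + (n2%:~R + a1 *~ r + a2 *~ s) *~ c2 =
  (c0 + n1 * c1 + n2 * c2)%:~R + a1 *~ (p * c1 + r * c2) + a2 *~ (q * c1 + s * c2).
Proof. by ring. Qed.

Lemma integral_basis_change (a1 a2 : K) (n1 n2 p q r s : int) :
  (p * s - q * r) ^+ 2 = 1 ->
  is_integral_basis a1 a2 ->
  is_integral_basis (n1%:~R + a1 *~ p + a2 *~ q) (n2%:~R + a1 *~ r + a2 *~ s).
Proof.
move=> det_sqr [gen_a free_a]; set det := p * s - q * r in det_sqr.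
have cramer1 c1 c2 : det * (s * (p * c1 + r * c2) - r * (q * c1 + s * c2)) = c1.
  by transitivity (det ^+ 2 * c1); [rewrite /det; ring | rewrite det_sqr mul1r].
have cramer2 c1 c2 : det * (p * (q * c1 + s * c2) - q * (p * c1 + r * c2)) = c2.
  by transitivity (det ^+ 2 * c2); [rewrite /det; ring | rewrite det_sqr mul1r].
split=> [x|c0 c1 c2]; last first.
  rewrite int_comb_comp => /free_a[c0_eq c1_eq c2_eq].
  have c1_0 : c1 = 0 by rewrite -(cramer1 c1 c2) c1_eq c2_eq; ring.
  have c2_0 : c2 = 0 by rewrite -(cramer2 c1 c2) c1_eq c2_eq; ring.
  by move: c0_eq; rewrite c1_0 c2_0 !mulr0 !addr0.
rewrite gen_a; split=> -[c0 [c1 [c2 ->]]]; last by rewrite int_comb_comp; do 3 eexists.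
pose d1 := det * (s * c1 - r * c2); pose d2 := det * (p * c2 - q * c1).
exists (c0 - n1 * d1 - n2 * d2), d1, d2; rewrite int_comb_comp.
have -> : p * d1 + r * d2 = c1.
  by transitivity (det ^+ 2 * c1); [rewrite /d1 /d2 /det; ring | rewrite det_sqr mul1r].
have -> : q * d1 + s * d2 = c2.
  by transitivity (det ^+ 2 * c2); [rewrite /d1 /d2 /det; ring | rewrite det_sqr mul1r].
by congr (_%:~R + _ + _); ring.
Qed.

Lemma integral_basisC (a1 a2 : K) : is_integral_basis a1 a2 -> is_integral_basis a2 a1.
Proof.
move=> /(@integral_basis_change _ _ 0 0 0 1 1 0 (erefl _)).
by rewrite !mulr0z !mulr1z !addr0 !add0r.
Qed.

Lemma integral_basis_int_comb (a1 a2 : K) (i j : int) :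
  is_integral_basis a1 a2 -> ring_of_integers (a1 *~ i + a2 *~ j).
Proof. by move=> [gen_a _]; apply/gen_a; exists 0, i, j; rewrite add0r. Qed.

Lemma integral_basis_unimodular (a1 a2 b1 b2 : K) :
  is_integral_basis a1 a2 -> is_integral_basis b1 b2 ->
  exists n1 n2 p q r s : int,
    [/\ b1 = n1%:~R + a1 *~ p + a2 *~ q, b2 = n2%:~R + a1 *~ r + a2 *~ s &
        (p * s - q * r) ^+ 2 = 1].
Proof.
move=> basis_a basis_b; have [gen_a free_a] := basis_a; have [gen_b _] := basis_b.
have mem_fst (x y : K) : is_integral_basis x y -> ring_of_integers x.
  by move=> basis; have := integral_basis_int_comb 1 0 basis; rewrite mulr1z mulr0z addr0.
have mem_snd (x y : K) : is_integral_basis x y -> ring_of_integers y.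
  by move/integral_basisC/mem_fst.
have [n1 [p [q b1_eq]]] := (gen_a b1).1 (mem_fst _ _ basis_b).
have [n2 [r [s b2_eq]]] := (gen_a b2).1 (mem_snd _ _ basis_b).
have [k1 [p' [q' a1_eq]]] := (gen_b a1).1 (mem_fst _ _ basis_a).
have [k2 [r' [s' a2_eq]]] := (gen_b a2).1 (mem_snd _ _ basis_a).
exists n1, n2, p, q, r, s; split=> //.
rewrite b1_eq b2_eq int_comb_comp in a1_eq; rewrite b1_eq b2_eq int_comb_comp in a2_eq.
have [_ /eqP + /eqP] : [/\ k1 + n1 * p' + n2 * q' = 0, p * p' + r * q' - 1 = 0 &
    q * p' + s * q' = 0].
  by apply: free_a; rewrite mulrzBr mulr1z addrA [_ - a1 + _]addrAC -a1_eq subrr.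
rewrite subr_eq0 => /eqP coord11 /eqP coord12.
have [_ /eqP + /eqP] : [/\ k2 + n1 * r' + n2 * s' = 0, p * r' + r * s' = 0 &
    q * r' + s * s' - 1 = 0].
  by apply: free_a; rewrite mulrzBr mulr1z addrA -a2_eq subrr.
rewrite subr_eq0 => /eqP coord21 /eqP coord22.
apply: (@int_unit_sqr _ (p' * s' - q' * r')).
transitivity ((p * p' + r * q') * (q * r' + s * s')
  - (q * p' + s * q') * (p * r' + r * s')).
  by ring.
by rewrite coord11 coord12 coord22 mul0r subr0.
Qed.

Lemma perp_int_comb (a1 a2 : K) (n p q : int) : \dim {:K} = 3%N ->
  perp (n%:~R + a1 *~ p + a2 *~ q) = perp a1 *~ p + perp a2 *~ q.
Proof.
move=> dimK; have -> : n%:~R = (n%:~R : rat)%:A :> K by rewrite scaler_int.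
by rewrite 2!raddfD !raddfMz /= perp_alg// add0r.
Qed.

Lemma minkowski_form_change (R : realType) (a1 a2 : K) (n1 n2 p q r s x y : int) :
  \dim {:K} = 3%N ->
  @minkowski_form R K (n1%:~R + a1 *~ p + a2 *~ q) (n2%:~R + a1 *~ r + a2 *~ s) x y =
  minkowski_form R a1 a2 (p * x + r * y) (q * x + s * y).
Proof.
move=> dimK; rewrite /minkowski_form !perp_int_comb//.
have := int_comb_comp (perp a1) (perp a2) 0 0 p q r s 0 x y.
by rewrite !mul0r !add0r => ->.
Qed.

Lemma shape_reduced_basis (R : realType) (z : R[i]) : \dim {:K} = 3%N ->
  @shape_points R K z ->
  exists a1 a2 : K, is_integral_basis a1 a2 /\
    exists2 r : R, 0 < r & forall x y : int,
      minkowski_form R a1 a2 x y = r * Normc.normc (x%:~R + y%:~R * z) ^+ 2.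
Proof.
move=> dimK [[z_gt0 _ _] [a1 [a2 [r [s [t [basis_a formE [g g_unit z_eq]]]]]]]].
have [r' r'_gt0 formE'] := GL2Z_act_form g_unit z_eq z_gt0.
exists (0%:~R + a1 *~ g 1 1 + a2 *~ g 1 0), (0%:~R + a1 *~ g 0 1 + a2 *~ g 0 0); split.
  apply: integral_basis_change basis_a.
  have -> : g 1 1 * g 0 0 - g 1 0 * g 0 1 = \det g by rewrite det_mx22; ring.
  exact: unit_det_sqr.
by exists r' => // x y; rewrite minkowski_form_change// formE formE'.
Qed.

End IntegralBasis.

(** * The shape of a field with a diagonal integral basis *)

Section DiagonalShape.
Variable R : realType.

Lemma normc_gauss_min (z : R[i]) (p q : int) : gauss_domain z -> q != 0 ->
  Normc.normc z ^+ 2 <= Normc.normc (p%:~R + q%:~R * z) ^+ 2.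
Proof.
move=> [_ /andP[x_ge0 x_le]]; rewrite sqr_normc_lincomb sqr_normc.
set x := complex.Re z in x_ge0 x_le *; set y := complex.Im z => norm_ge1 q_neq0.
have q2_ge1 : 1 <= (q%:~R : R) ^+ 2.
  by rewrite -rmorphXn -[1]/(1%:~R) ler_int /=; nia.
have form_ge1 : 1 <= (p%:~R : R) ^+ 2 - `|p%:~R * q%:~R| + q%:~R ^+ 2.
  rewrite -rmorphM -intr_norm -!rmorphXn -rmorphB -rmorphD -[1]/(1%:~R) ler_int /=.
  by nia.
have cross_ge : - `|p%:~R * q%:~R : R| <= 2 * x * (p%:~R * q%:~R).
  have := ler_norm (p%:~R * q%:~R : R); have := ler_norm (- (p%:~R * q%:~R : R)).
  have := normr_ge0 (p%:~R * q%:~R : R); rewrite normrN; nra.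
have : (q%:~R ^+ 2 - 1) * 1 <= (q%:~R ^+ 2 - 1) * (x ^+ 2 + y ^+ 2).
  by rewrite ler_wpM2l// subr_ge0.
by lra.
Qed.

Lemma gauss_interior_Re_not_int (z : R[i]) (k : int) :
  gauss_interior z -> complex.Re z <> k%:~R.
Proof.
move=> [x_gt0 x_lt _] x_eq; rewrite x_eq ltr0z gtz0_ge1 in x_gt0.
have : 1%:~R <= k%:~R :> R by rewrite ler_int.
by lra.
Qed.

Section DiagonalForm.
Variables (A B c : R) (z : R[i]) (p q r s : int).
Hypotheses (A_gt0 : 0 < A) (B_gt0 : 0 < B) (det_sqr : (p * s - q * r) ^+ 2 = 1).
Hypothesis formE : forall x y : int,
  A * (p * x + r * y)%:~R ^+ 2 + B * (q * x + s * y)%:~R ^+ 2 =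
  c * Normc.normc (x%:~R + y%:~R * z) ^+ 2.

Lemma diagonal_form_lead : c = A * p%:~R ^+ 2 + B * q%:~R ^+ 2.
Proof.
have := formE 1 0; rewrite !mulr1 !mulr0 !addr0 => ->.
by rewrite mul0r addr0 Normc.normc1 expr1n mulr1.
Qed.

Lemma diagonal_form_cross :
  c * complex.Re z = A * p%:~R * r%:~R + B * q%:~R * s%:~R.
Proof.
have := formE 1 1; have := formE 1 0; have := formE 0 1.
by rewrite !sqr_normc_lincomb !mulr1 !mulr0 !add0r !addr0 !rmorphD /=; lra.
Qed.

Lemma diagonal_form_axis : p = 0 \/ q = 0 -> exists k : int, complex.Re z = k%:~R.
Proof.
have sqr1 (k l : int) : (k * l) ^+ 2 = 1 -> k%:~R ^+ 2 = 1 :> R.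
  move=> kl_sqr; rewrite -rmorphXn (_ : k ^+ 2 = 1)//.
  by apply: (@int_unit_sqr _ (k * l ^+ 2)); rewrite -kl_sqr; ring.
case=> coord0; have := diagonal_form_cross; rewrite diagonal_form_lead coord0.
  rewrite (sqr1 q r); last by rewrite -det_sqr coord0; ring.
  rewrite expr0n mulr0 mul0r !add0r mulr1 -mulrA => /(mulfI (lt0r_neq0 B_gt0)) ->.
  by exists (q * s); rewrite rmorphM.
rewrite (sqr1 p s); last by rewrite -det_sqr coord0; ring.
rewrite expr0n !mulr0 !mul0r !addr0 mulr1 -mulrA => /(mulfI (lt0r_neq0 A_gt0)) ->.
by exists (p * r); rewrite rmorphM.
Qed.

Lemma diagonal_form_boundary : gauss_domain z -> boundary (@gauss_domain R) z.
Proof.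
move=> gauss_z; apply/(gauss_domain_boundaryP gauss_z).
have [//|z_interior] := gauss_domain_edgeVinterior gauss_z; exfalso.
have not_int k : complex.Re z <> k%:~R := gauss_interior_Re_not_int z_interior.
have p_neq0 : p != 0.
  by apply/eqP => p0; have [|k /not_int] := diagonal_form_axis; first by left.
have q_neq0 : q != 0.
  by apply/eqP => q0; have [|k /not_int] := diagonal_form_axis; first by right.
have c_gtA : A < c.
  have p2_ge1 : 1 <= (p%:~R : R) ^+ 2.
    by rewrite -rmorphXn -[1]/(1%:~R) ler_int /=; nia.
  have q2_gt0 : 0 < (q%:~R : R) ^+ 2 by rewrite exprn_even_gt0 //= intr_eq0.
  have : A * 1 <= A * p%:~R ^+ 2 by rewrite ler_pM2l.
  have : 0 < B * q%:~R ^+ 2 by rewrite mulr_gt0.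
  by rewrite diagonal_form_lead; lra.
have c_gt0 : 0 < c by apply: lt_trans c_gtA.
(* The first diagonal basis vector has coordinates (s, - q) up to sign. *)
have A_eq : A = c * Normc.normc (s%:~R + (- q)%:~R * z) ^+ 2.
  rewrite -formE; have -> : p * s + r * - q = p * s - q * r by ring.
  have -> : q * s + s * - q = 0 by ring.
  by rewrite -rmorphXn det_sqr mulr1 expr0n mulr0 addr0.
have : c * Normc.normc z ^+ 2 <= A.
  by rewrite A_eq ler_pM2l// normc_gauss_min ?oppr_eq0.
have : c * 1 < c * Normc.normc z ^+ 2.
  by rewrite ltr_pM2l// sqr_normc; case: z_interior.
by lra.
Qed.

End DiagonalForm.

Variable K : fieldExtType rat.

Lemma shape_points_diagonal (a1 a2 : K) (A B : R) :
  is_integral_basis a1 a2 -> 0 < A -> A <= B ->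
  (forall x y : int, minkowski_form R a1 a2 x y = A * x%:~R ^+ 2 + B * y%:~R ^+ 2) ->
  @shape_points R K (form_root A 0 B).
Proof.
move=> basis A_gt0 A_leB formE; have B_gt0 : 0 < B := lt_le_trans A_gt0 A_leB.
have disc_gt0 : 0 < 4 * A * B - 0 ^+ 2 by rewrite expr0n subr0 !mulr_gt0.
split.
  split; rewrite /= ?mul0r ?lexx ?invr_ge0 ?ler0n//.
    by rewrite divr_gt0 ?mulr_gt0 ?sqrtr_gt0.
  rewrite expr_div_n sqr_sqrtr ?(ltW disc_gt0)// expr0n /= add0r subr0.
  by rewrite ler_pdivlMr ?exprn_gt0 ?mulr_gt0//; nra.
exists a1, a2, A, 0, B; split=> // [x y|]; first by rewrite formE; ring.
exists 1%:M; first exact: unitmx1.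
by rewrite /GL2Z_act det1 eqxx !mxE /= !mul1r !addr0 mul0r add0r divr1.
Qed.

Lemma diagonal_basis_boundary (a1 a2 : K) (A B : R) : \dim {:K} = 3%N ->
  is_integral_basis a1 a2 -> 0 < A -> 0 < B ->
  (forall x y : int, minkowski_form R a1 a2 x y = A * x%:~R ^+ 2 + B * y%:~R ^+ 2) ->
  boundary (@gauss_domain R) (field_shape R K).
Proof.
move=> dimK basis A_gt0 B_gt0 formE.
have shape_ex : exists z, @shape_points R K z.
  have [A_leB|/ltW B_leA] := leP A B.
    by exists (form_root A 0 B); apply: shape_points_diagonal formE.
  exists (form_root B 0 A); apply: (shape_points_diagonal (integral_basisC basis)) => //.
  by move=> x y; rewrite addrC -formE /minkowski_form addrC.
have shape_z : @shape_points R K (field_shape R K) by apply: xgetPex.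
have [b1 [b2 [basis_b [c c_gt0 formE_b]]]] := shape_reduced_basis dimK shape_z.
have [n1 [n2 [p [q [r [s [b1_eq b2_eq det_sqr]]]]]]] :=
  integral_basis_unimodular basis basis_b.
apply: (diagonal_form_boundary A_gt0 B_gt0 det_sqr (c := c)); last by case: shape_z.
by move=> x y; rewrite -formE_b b1_eq b2_eq minkowski_form_change// formE.
Qed.

End DiagonalShape.

(** * The shape of a wild pure cubic field *)

Lemma complex_cube_root_unity (R : realType) :
  exists z : R[i], [/\ z ^+ 3 = 1, conjc z = z ^+ 2 & complex.Im z != 0].
Proof.
pose s : R := Num.sqrt 3; have s_sqr : s * s = 3 by rewrite -expr2 sqr_sqrtr.
have s_neq0 : s != 0 by rewrite sqrtr_eq0 -ltNge.
pose z : R[i] := Complex (- 2^-1) (s / 2).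
have z_sqr : z ^+ 2 = conjc z.
  apply/eqP; rewrite eq_complex /=; apply/andP; split; apply/eqP; last by field.
  by transitivity (1 / 4 - s * s / 4); [field | rewrite s_sqr; field].
exists z; split=> //; last by rewrite mulf_neq0.
rewrite exprS z_sqr; apply/eqP; rewrite eq_complex /=; apply/andP; split; apply/eqP;
  last by ring.
by transitivity (1 / 4 + s * s / 4); [field | rewrite s_sqr; field].
Qed.

Lemma real_cube_root (R : realType) (x : R) : 0 < x -> exists2 y : R, 0 < y & y ^+ 3 = x.
Proof.
move=> x_gt0; exists (x `^ 3^-1); first exact: powR_gt0.
by rewrite -powR_mulrn ?powR_ge0// -powRrM mulVf// powRr1// ltW.
Qed.

Section PureTrace.
Variables (K : fieldExtType rat) (a b : nat) (al be : K).
Hypothesis pure_ab : pure_pair a b al be.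

Lemma pure_dim : \dim {:K} = 3%N.
Proof. exact: dim_rational_basis (pure_basis pure_ab). Qed.

Lemma pure_field_trace (x0 x1 x2 : rat) : field_trace (rat_comb al be x0 x1 x2) = 3 * x0.
Proof.
have [a_free b_free _ _ _] := pure_ab.
have [r [s [z [sigma [rel z_prim sigmaE]]]]] := pure_algC_embeddings pure_ab.
have r_neq0 : r != 0.
  apply/eqP => r0; have /esym/eqP := pure_relations_cube rel.
  rewrite r0 expr0n mulf_eq0 sqrf_eq0.
  by rewrite !(negPf (power_free_natr_neq0 _ a_free), negPf (power_free_natr_neq0 _ b_free)).
apply: (fmorph_inj (@ratr algC)).
rewrite /= (field_trace_sum _ pure_dim (sigma := sigma)).
  by rewrite sum_ord3 (pure_conjugates_sum z_prim sigmaE).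
move=> i j /(congr1 (fun f => f al)); rewrite !(sigmaE _).1 => /(mulIf r_neq0)/eqP.
by rewrite (eq_prim_root_expr z_prim) !modn_small// => /eqP/val_inj.
Qed.

Lemma pure_perp (x0 x1 x2 : rat) :
  perp (rat_comb al be x0 x1 x2) = rat_comb al be 0 (3 * x1) (3 * x2).
Proof.
rewrite /perp pure_field_trace -[_%:A]/(in_alg K _).
by rewrite /rat_comb !rmorphM !rmorph_nat rmorph0; ring.
Qed.

Lemma wild_integral_basis : ~~ tame_radicand a b -> is_integral_basis al be.
Proof.
move=> wild_ab; split=> [x|n0 n1 n2].
  split=> [/(wild_integers pure_ab wild_ab)[n0 [n1 [n2 ->]]]|[n0 [n1 [n2 ->]]]].
    by exists n0, n1, n2; rewrite rat_comb_intr.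
  by rewrite -rat_comb_intr; apply: ring_of_integers_int_comb pure_ab _ _ _.
rewrite -rat_comb_intr => /(pure_basis pure_ab).2[/eqP + /eqP + /eqP].
by rewrite !intr_eq0 => /eqP-> /eqP-> /eqP->.
Qed.

Variable R : realType.

Lemma pure_cubic_embeddings :
  exists (rho : {rmorphism K -> R}) (g : {rmorphism K -> R[i]}),
    [/\ 0 < rho al, 0 < rho be & cubic_embeddings rho g].
Proof.
have [a_free b_free _ _ _] := pure_ab.
have a_gt0 : (0 : R) < a%:R by rewrite ltr0n (power_free_gt0 a_free).
have b_gt0 : (0 : R) < b%:R by rewrite ltr0n (power_free_gt0 b_free).
have [r r_gt0 r_cube] := real_cube_root (mulr_gt0 a_gt0 (exprn_gt0 2 b_gt0)).
have rel := cube_root_relations (lt0r_neq0 b_gt0) r_cube.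
have [rho [rho_al rho_be]] := pure_rmorph pure_ab rel.
have [z [z_cube z_conj z_im]] := complex_cube_root_unity R.
pose c : R[i] := real_complex R r.
have relC : pure_relations a b c (real_complex R (r ^+ 2 / b%:R)).
  have [rr ss rs] := rel; rewrite /c; split; rewrite -rmorphM.
  - by rewrite rr rmorphM rmorph_nat.
  - by rewrite ss rmorphM rmorph_nat.
  - by rewrite rs rmorphM !rmorph_nat.
have [g [g_al _]] := pure_rmorph pure_ab (pure_relations_twist z_cube relC).
exists rho, g; split; first by rewrite rho_al.
  by rewrite rho_be divr_gt0// exprn_gt0.
split.
  exists al; rewrite g_al /c; case: (z) z_im => u v /= v_neq0.
  by rewrite mulr0 add0r mulf_neq0// gt_eqF.
apply/seteqP; split=> [_ [phi ->]|_ [i _ <-]]; last by exists (cubic_embedding rho g i).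
have z_sum : z ^+ 2 + z + 1 = 0.
  have z_neq1 : z - 1 != 0 by apply: contraNneq z_im => /eqP; rewrite subr_eq0 => /eqP->.
  by apply: (mulfI z_neq1); rewrite mulr0; transitivity (z ^+ 3 - 1);
    [ring | rewrite z_cube subrr].
have : (phi al - c) * (phi al - z * c) * (phi al - z ^+ 2 * c) = 0.
  transitivity (phi al ^+ 3 - c ^+ 3 - (z ^+ 2 + z + 1) *
     (phi al ^+ 2 * c - z * phi al * c ^+ 2 + (z - 1) * c ^+ 3)); first by ring.
  rewrite z_sum mul0r subr0 (pure_relations_cube relC) -rmorphXn.
  rewrite (pure_relations_cube (pure_pair_relations pure_ab)).
  by rewrite rmorphM rmorphXn !rmorph_nat subrr.
move=> /eqP; rewrite !mulf_eq0 !subr_eq0 -!orbA => /or3P[]/eqP phi_al.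
- exists 0 => //; apply: (pure_rmorph_ext pure_ab).
  by rewrite phi_al /cubic_embedding /= rho_al.
- by exists 1 => //; apply: (pure_rmorph_ext pure_ab); rewrite phi_al -g_al.
- exists 2 => //; apply: (pure_rmorph_ext pure_ab).
  rewrite phi_al /cubic_embedding /= g_al (rmorphM (@conjc R)).
  by congr (_ * _); [exact: z_conj | exact: conjc_real].
Qed.

Lemma pure_minkowski_form (rho : {rmorphism K -> R}) (g : {rmorphism K -> R[i]})
    (x y : int) :
  cubic_embeddings rho g -> minkowski_form R al be x y =
    27 * rho al ^+ 2 * x%:~R ^+ 2 + 27 * rho be ^+ 2 * y%:~R ^+ 2.
Proof.
move=> emb; rewrite (minkowski_formE pure_dim emb).
have -> : al *~ x + be *~ y = rat_comb al be 0 x%:~R y%:~R.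
  by rewrite -[0]/(0%:~R) rat_comb_intr add0r.
rewrite pure_perp /minkowski_norm [rat_comb _ _ _ _ _ ^+ 2]expr2
  (rat_combM pure_ab) pure_field_trace.
rewrite rmorph_rat_comb.
have [_ _ albe] := pure_pair_relations pure_ab.
have rho_albe : rho al * rho be = a%:R * b%:R.
  by rewrite -rmorphM albe rmorphM !rmorph_nat.
pose A : {rmorphism rat -> R} := @ratr R; rewrite -![ratr _]/(A _).
transitivity (27 * rho al ^+ 2 * x%:~R ^+ 2 + 27 * rho be ^+ 2 * y%:~R ^+ 2
  + 54 * (rho al * rho be - a%:R * b%:R) * x%:~R * y%:~R); first by ring.
by rewrite rho_albe; ring.
Qed.

End PureTrace.

(** * Fields with shape on the boundary *)

(* Orthogonality of the perps for the Minkowski form is encoded by the rationality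
   of their product. *)
Definition orthogonal_frame (K : fieldExtType rat) (D : int) (c1 c2 : K) : Prop :=
  [/\ ring_of_integers c1 /\ ring_of_integers c2, perp c1 != 0 /\ perp c2 != 0,
      exists q : rat, perp c1 * perp c2 = q%:A &
      forall x, ring_of_integers x ->
        exists i j : int, perp x *~ D = perp c1 *~ i + perp c2 *~ j].

Section BoundaryFrame.
Variables (R : realType) (K : fieldExtType rat).
Variables (rho : {rmorphism K -> R}) (g : {rmorphism K -> R[i]}).
Hypotheses (dimK : \dim {:K} = 3%N) (emb : cubic_embeddings rho g).

Lemma orthogonal_frame_of_form (a1 a2 : K) (c : R) (z : R[i]) (p q r s : int) :
  is_integral_basis a1 a2 -> 0 < c -> 0 < complex.Im z ->
  (forall x y : int,
     minkowski_form R a1 a2 x y = c * Normc.normc (x%:~R + y%:~R * z) ^+ 2) ->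
  p * s - q * r != 0 ->
  Normc.normc ((p + r)%:~R + (q + s)%:~R * z) ^+ 2 =
    Normc.normc ((p - r)%:~R + (q - s)%:~R * z) ^+ 2 ->
  orthogonal_frame (p * s - q * r) (a1 *~ p + a2 *~ q) (a1 *~ r + a2 *~ s).
Proof.
move=> basis c_gt0 im_gt0 formE det_neq0 norm_eq.
have normE x y : minkowski_norm rho (perp (a1 *~ x + a2 *~ y)) =
    c * Normc.normc (x%:~R + y%:~R * z) ^+ 2.
  by rewrite -(minkowski_formE dimK emb).
have perp_eq0 (x y : int) : perp (a1 *~ x + a2 *~ y) = 0 -> x = 0 /\ y = 0.
  move=> perp0; have := normE x y; rewrite perp0 /minkowski_norm !expr0n linear0 !rmorph0.
  rewrite expr0n mulr0 subr0 sqr_normc_lincomb => /esym/eqP.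
  rewrite mulf_eq0 (gt_eqF c_gt0) paddr_eq0 ?sqr_ge0// !sqrf_eq0 mulf_eq0.
  rewrite (gt_eqF im_gt0) orbF intr_eq0 => /andP[+ /eqP y0].
  by rewrite y0 mul0r addr0 intr_eq0 => /eqP.
split.
- by split; apply: integral_basis_int_comb.
- by split; apply: contra_neq det_neq0 => /perp_eq0[-> ->]; ring.
- apply: (@rational_mul_of_minkowski_norm R K rho).
  rewrite -raddfD -raddfB.
  have -> : a1 *~ p + a2 *~ q + (a1 *~ r + a2 *~ s) =
    a1 *~ (p + r) + a2 *~ (q + s) by ring.
  have -> : a1 *~ p + a2 *~ q - (a1 *~ r + a2 *~ s) =
    a1 *~ (p - r) + a2 *~ (q - s) by ring.
  by rewrite !normE norm_eq.
- move=> x /basis.1[n0 [n1 [n2 ->]]].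
  rewrite (perp_int_comb _ _ _ _ _ dimK) !raddfD !raddfMz /=.
  exists (s * n1 - r * n2), (p * n2 - q * n1).
  by ring.
Qed.

Lemma boundary_orthogonal_frame (z : R[i]) :
  @shape_points R K z -> boundary (@gauss_domain R) z ->
  exists (D : int) (c1 c2 : K), ~~ (3 %| D)%Z /\ orthogonal_frame D c1 c2.
Proof.
move=> shape_z; have gauss_z : gauss_domain z by case: shape_z.
have [im_gt0 _ _] := gauss_z.
have [a1 [a2 [basis [c c_gt0 formE]]]] := shape_reduced_basis dimK shape_z.
have frame (p q r s : int) : ~~ (3 %| p * s - q * r)%Z ->
    Normc.normc ((p + r)%:~R + (q + s)%:~R * z) ^+ 2 =
      Normc.normc ((p - r)%:~R + (q - s)%:~R * z) ^+ 2 ->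
    exists (D : int) (c1 c2 : K), ~~ (3 %| D)%Z /\ orthogonal_frame D c1 c2.
  move=> det_ndvd norm_eq; do 3 eexists; split; first exact: det_ndvd.
  apply: (orthogonal_frame_of_form basis c_gt0 im_gt0 formE) norm_eq.
  by apply: contraNneq det_ndvd => ->; apply: dvdz0.
case/(gauss_domain_boundaryP gauss_z) => [x_eq|x_eq|norm_eq].
- by apply: (frame 1 0 0 1) => //; rewrite !sqr_normc_lincomb x_eq; ring.
- by apply: (frame (-1) 2 1 0) => //; rewrite !sqr_normc_lincomb x_eq; field.
- apply: (frame 1 1 1 (-1)) => //; rewrite !sqr_normc_lincomb.
  apply/eqP; rewrite -subr_eq0; apply/eqP.
  transitivity (4 * (1 - (complex.Re z ^+ 2 + complex.Im z ^+ 2))); first by ring.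
  by rewrite norm_eq subrr mulr0.
Qed.

Lemma shape_points_of_boundary :
  boundary (@gauss_domain R) (field_shape R K) -> @shape_points R K (field_shape R K).
Proof.
move=> bz; have [shape_ex|no_shape] := pselect (exists z, @shape_points R K z).
  exact: xgetPex.
exfalso; apply: (@zero_notin_gauss_boundary R); move: bz.
by rewrite /field_shape xgetPN// => z shape_z; apply: no_shape; exists z.
Qed.

(* The conjugates of x satisfy e1 = e2 = 0, so their cubes all equal their product. *)
Lemma cube_rational_of_traceless (x y : K) (q : rat) :
  x != 0 -> y != 0 -> field_trace x = 0 -> field_trace y = 0 -> x * y = q%:A ->
  exists n : rat, x ^+ 3 = n%:A.
Proof.
move=> x_neq0 y_neq0 tr_x tr_y xy; pose sigma := cubic_embedding rho g.
have traceE t : ratr (field_trace t) = sigma 0 t + sigma 1 t + sigma 2 t :> R[i].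
  by rewrite -(sum_ord3 (fun i => sigma i t));
    apply: field_trace_sum dimK (cubic_embedding_inj emb.1).
have sum_x : sigma 0 x + sigma 1 x + sigma 2 x = 0.
  by rewrite -traceE tr_x rmorph0.
have sum_y : sigma 0 y + sigma 1 y + sigma 2 y = 0.
  by rewrite -traceE tr_y rmorph0.
have mul_xy i : sigma i x * sigma i y = ratr q.
  by rewrite -rmorphM xy rmorphZ_rat rmorph1 mulr1.
have q_neq0 : (ratr q : R[i]) != 0 by rewrite -(mul_xy 0) mulf_neq0 ?fmorph_eq0.
have sym2 : sigma 1 x * sigma 2 x + sigma 0 x * sigma 2 x + sigma 0 x * sigma 1 x = 0.
  apply: (mulfI q_neq0); rewrite mulr0.
  transitivity (sigma 1 x * sigma 2 x * (sigma 0 x * sigma 0 y)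
    + sigma 0 x * sigma 2 x * (sigma 1 x * sigma 1 y)
    + sigma 0 x * sigma 1 x * (sigma 2 x * sigma 2 y)); first by rewrite !mul_xy; ring.
  transitivity (sigma 0 x * sigma 1 x * sigma 2 x * (sigma 0 y + sigma 1 y + sigma 2 y)).
    by ring.
  by rewrite sum_y mulr0.
have cubeE (X : R[i]) : (X - sigma 0 x) * (X - sigma 1 x) * (X - sigma 2 x) = 0 ->
    X ^+ 3 = sigma 0 x * sigma 1 x * sigma 2 x.
  move=> X_root; transitivity ((X - sigma 0 x) * (X - sigma 1 x) * (X - sigma 2 x)
    + X ^+ 2 * (sigma 0 x + sigma 1 x + sigma 2 x)
    - X * (sigma 1 x * sigma 2 x + sigma 0 x * sigma 2 x + sigma 0 x * sigma 1 x)
    + sigma 0 x * sigma 1 x * sigma 2 x); first by ring.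
  by rewrite X_root sum_x sym2; ring.
have cube0 : sigma 0 x ^+ 3 = sigma 0 x * sigma 1 x * sigma 2 x by apply: cubeE; ring.
have cube1 : sigma 1 x ^+ 3 = sigma 0 x * sigma 1 x * sigma 2 x by apply: cubeE; ring.
have cube2 : sigma 2 x ^+ 3 = sigma 0 x * sigma 1 x * sigma 2 x by apply: cubeE; ring.
exists (field_trace (x ^+ 3) / 3); apply: (fmorph_inj (sigma 0)).
rewrite rmorphZ_rat rmorph1 mulr1 fmorph_div rmorph_nat /= traceE !rmorphXn.
by rewrite cube1 cube2 -cube0; field.
Qed.

End BoundaryFrame.

Lemma real_cube_inj (R : realFieldType) : injective (fun x : R => x ^+ 3).
Proof.
move=> x y /= cube_eq; apply/eqP; rewrite -subr_eq0.
have : (x - y) * (x ^+ 2 + x * y + y ^+ 2) = 0.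
  by transitivity (x ^+ 3 - y ^+ 3); [ring | rewrite cube_eq subrr].
move=> /eqP; rewrite mulf_eq0 => /orP[//|/eqP sum0].
have : (x - y) ^+ 2 <= 0 by nra.
by rewrite le_eqVlt ltNge sqr_ge0 orbF sqrf_eq0.
Qed.

Lemma adjoin_full_of_prime_dim (F : fieldType) (L : fieldExtType F) (x : L) :
  prime (\dim {:L}) -> (forall c : F, x <> c%:A) -> <<1; x>>%VS = {:L}%VS.
Proof.
move=> dim_prime not_scalar; apply/eqP; rewrite eqEdim subvf /=.
have : (\dim <<1; x>> %| \dim {:L})%N by apply: field_dimS; apply: subvf.
move=> /(prime_nt_dvdP dim_prime)-> //; apply/eqP => dim1.
suff : x \in 1%VS by move=> /vlineP[c]; apply: not_scalar.
have -> : 1%VS = <<1; x>>%VS :> {vspace L}; last exact: (memv_adjoin 1%AS x).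
by apply/eqP; rewrite eqEdim dim1 dimv1 leqnn andbT; apply: (subv_adjoin 1%AS x).
Qed.

Lemma pure_of_rational_cube (R : realType) (K : fieldExtType rat)
    (rho : {rmorphism K -> R}) (x : K) (n : rat) : \dim {:K} = 3%N ->
  (forall c : rat, x <> c%:A) -> x ^+ 3 = n%:A -> is_pure_cubic K.
Proof.
move=> dimK not_rational x_cube; exists n; split; last first.
  by exists x; split=> //; apply: adjoin_full_of_prime_dim => //; rewrite dimK.
move=> c c_cube; apply: (not_rational c); apply: (embedding_rational (rho := rho)).
apply: real_cube_inj; rewrite /= -rmorphXn x_cube rmorphZ_rat rmorph1 mulr1 -c_cube.
by rewrite rmorphXn.
Qed.

Lemma pure_of_orthogonal_frame (R : realType) (K : fieldExtType rat)
    (rho : {rmorphism K -> R}) (g : {rmorphism K -> R[i]}) (D : int) (c1 c2 : K) :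
  \dim {:K} = 3%N -> cubic_embeddings rho g -> orthogonal_frame D c1 c2 -> is_pure_cubic K.
Proof.
move=> dimK emb [_ [perp1 perp2] [q mul_eq] _].
have tr_perp x : field_trace (perp x) = 0 := field_trace_perp x dimK.
have [n cube_eq] := cube_rational_of_traceless dimK emb perp1 perp2
  (tr_perp c1) (tr_perp c2) mul_eq.
apply: (pure_of_rational_cube rho dimK _ cube_eq) => c c_eq.
move: (tr_perp c1) perp1; rewrite c_eq field_trace_alg dimK => /eqP.
by rewrite mulf_eq0 /= => /eqP->; rewrite scale0r eqxx.
Qed.

Section TameFrame.
Variables (K : fieldExtType rat) (a b : nat) (al be : K).
Hypothesis pure_ab : pure_pair a b al be.
Local Notation m := (pure_radicand a b).

Lemma perp_third_comb (y0 y1 y2 : int) :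
  perp (third_comb al be y0 y1 y2) = rat_comb al be 0 y1%:~R y2%:~R.
Proof. by rewrite (pure_perp pure_ab); congr rat_comb; field. Qed.

Lemma tame_axis_dvd3 (y0 y1 y2 : int) : tame_radicand a b ->
  ring_of_integers (third_comb al be y0 y1 y2) -> y1 = 0 \/ y2 = 0 ->
  (3 %| y1)%Z /\ (3 %| y2)%Z.
Proof.
move=> /tame_factors_ndvd3[a_ndvd b_ndvd] Oy axis.
have [y1_congr y2_congr] := pure_thirds_congr pure_ab a_ndvd b_ndvd Oy.
have y0_dvd : (3 %| y0)%Z.
  case: axis => y_eq; [move: y1_congr | move: y2_congr];
    rewrite y_eq sub0r rpredN (@Euclid_dvdzM 3)//.
    by case/orP => [/(negP a_ndvd)|].
  by case/orP => [/(negP b_ndvd)|].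
exact: (pure_thirds_dvd_lead pure_ab a_ndvd b_ndvd Oy y0_dvd).
Qed.

(* The coordinates of the perps in a frame are divisible by 3, unlike those of
   [tame_elt]. *)
Lemma tame_frame_index (D : int) (c1 c2 : K) :
  tame_radicand a b -> orthogonal_frame D c1 c2 -> (3 %| D)%Z.
Proof.
move=> tame_ab [[Oc1 Oc2] [perp1 perp2] [q mul_eq] span].
have [y0 [y1 [y2 c1_eq]]] := pure_thirds pure_ab Oc1.
have [z0 [z1 [z2 c2_eq]]] := pure_thirds pure_ab Oc2.
rewrite c1_eq in Oc1; rewrite c2_eq in Oc2.
rewrite c1_eq c2_eq !perp_third_comb in perp1 perp2 mul_eq span.
have basis := pure_basis pure_ab; have [a_free b_free _ _ _] := pure_ab.
have comb_neq0 (n1 n2 : int) :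
  rat_comb al be 0 n1%:~R n2%:~R != 0 -> (n1 != 0) || (n2 != 0).
  apply: contraNT; rewrite negb_or !negbK => /andP[/eqP-> /eqP->].
  by rewrite -rat_comb_alg rmorph0.
have [yz1 yz2] : (y1 = 0 \/ z1 = 0) /\ (y2 = 0 \/ z2 = 0).
  move: mul_eq; rewrite (rat_combM pure_ab) -[q%:A]/(in_alg K q) (rat_comb_alg al be).
  move=> /(rat_comb_inj basis)[_ /eqP + /eqP].
  rewrite !mul0r !mulr0 !add0r !mulf_eq0 !pnatr_eq0 !eqn0Ngt.
  rewrite (power_free_gt0 a_free) (power_free_gt0 b_free) /= !intr_eq0.
  by move=> /orP[]/eqP-> /orP[]/eqP->; split; tauto.
have {}perp1 := comb_neq0 _ _ perp1; have {}perp2 := comb_neq0 _ _ perp2.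
have [y_axis z_axis] : (y1 = 0 \/ y2 = 0) /\ (z1 = 0 \/ z2 = 0).
  by move: yz1 yz2 perp1 perp2 => [->|->] [->|->]; rewrite ?eqxx //=; split; auto.
have [/dvdzP[y1' y1_eq] _] := tame_axis_dvd3 tame_ab Oc1 y_axis.
have [/dvdzP[z1' z1_eq] _] := tame_axis_dvd3 tame_ab Oc2 z_axis.
have [i [j]] := span _ ((tame_elt_integralP pure_ab).2 tame_ab).
rewrite /tame_elt perp_third_comb !rat_comb_mulrz rat_combD.
move=> /(rat_comb_inj basis)[_ m_eq _].
have : (3 %| D * m)%Z.
  apply/dvdzP; exists (i * y1' + j * z1'); apply/eqP;
    rewrite -(eqr_int rat) rmorphM /= m_eq.
  by rewrite y1_eq z1_eq !(rmorphD, rmorphM) /=; apply/eqP; ring.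
by rewrite (@Euclid_dvdzM 3)// (negPf (tame_radicand_ndvd3 tame_ab)) orbF.
Qed.

End TameFrame.

Theorem theoremF (R : realType) (K : fieldExtType rat) :
  (is_complex_cubic R K /\ boundary (@gauss_domain R) (field_shape R K)) <->
  is_wild_pure_cubic K.
Proof.
split=> [[cubicK bz]|[pureK wildK]].
  have [dimK _ _] := cubicK; have [rho [g emb]] := complex_cubic_embeddings cubicK.
  have shape_z := shape_points_of_boundary bz.
  have [D [c1 [c2 [D_ndvd frame]]]] := boundary_orthogonal_frame dimK emb shape_z bz.
  have pureK := pure_of_orthogonal_frame dimK emb frame.
  have [a [b [al [be pure_ab]]]] := pure_pair_exists pureK.
  split=> //; apply/(wildly_ramified_pureP pure_ab).
  by apply: contra D_ndvd => tame_ab; exact: (tame_frame_index pure_ab tame_ab frame).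
have [a [b [al [be pure_ab]]]] := pure_pair_exists pureK.
have dimK := pure_dim pure_ab.
have basis := wild_integral_basis pure_ab ((wildly_ramified_pureP pure_ab).1 wildK).
have [rho [g [al_gt0 be_gt0 emb]]] := pure_cubic_embeddings pure_ab R.
split; first exact: is_complex_cubic_of_embeddings dimK emb.
apply: (diagonal_basis_boundary dimK basis)
  (fun x y => pure_minkowski_form pure_ab x y emb).
  by rewrite mulr_gt0// exprn_gt0.
by rewrite mulr_gt0// exprn_gt0.
Qed.
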